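(* Let $f(x)$ be a meromorphic function of $x^2$ having only simple and double poles, denoted by $\pm\alpha_j^{-1/2}$, $j=1,2,\dots$. Suppose that $|\alpha_1|^{-1/2}>1$ and $|\alpha_j|^{-1/2}<|\alpha_{j'}|^{-1/2}$ if $j<j'$, and denote by $f_l$ the coefficients of the Taylor expansion $f(x)=\sum_{l=0}^\infty f_l\,x^{2l}$ for $|x|<|\alpha_1|^{-1/2}$. Let $t(z)$ be a generating functional with modes $t_n=\oint_C\frac{dz}{2\pi iz}z^{-n}t(z)$. Then the relation (for all $n,m\in\mathbb Z$) $$\left(\oint_{C_1}\frac{dz}{2\pi iz}\oint_{C_2}\frac{dw}{2\pi iw}+\oint_{C_2}\frac{dz}{2\pi iz}\oint_{C_1}\frac{dw}{2\pi iw}\right)z^{-n}w^{-m}\big[f(z/w)\,t(z)\,t(w)-f(w/z)\,t(w)\,t(z)\big]=0,$$ where $C_1$ and $C_2$ are circles of radii respectively $R_1$ and $R_2$, defines a family of exchange relations for the modes $t_n$ depending on $R_1/R_2$. If $R_1/R_2\in[1,|\alpha_1|^{\pm1/2}[$, one has $$\sum_{l=0}^\infty f_l\,(t_{n-2l}t_{m+2l}-t_{m-2l}t_{n+2l})=0,$$ while in the regions $R_1/R_2\in\,]|\alpha_{j_0}|^{\pm1/2},|\alpha_{j_0+1}|^{\pm1/2}[$ the exchange relation becomes $$\sum_{l\in\mathbb Z}f_l^{(j_0)}\,(t_{n-2l}t_{m+2l}-t_{m-2l}t_{n+2l})=0,$$ where $f_l^{(j_0)}$ ($l\in\mathbb Z$)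 is obtained by adding to $f_l$ (with $f_l=0$ for $l<0$) the contributions $$-\tfrac12\,\alpha_j^l\,\big[(1-\alpha_jx^2)f(x)\big]\Big|_{x=\alpha_j^{-1/2}}$$ for every simple pole $\alpha_j^{-1/2}$ such that $1\le j\le j_0$, and the contributions $$-\tfrac12\,(l+1)\,\alpha_j^l\,\big[(1-\alpha_jx^2)^2f(x)\big]\Big|_{x=\alpha_j^{-1/2}}+\tfrac14\,\alpha_j^{l-1/2}\,\frac{d}{dx}\big[(1-\alpha_jx^2)^2f(x)\big]\Big|_{x=\alpha_j^{-1/2}}$$ for every double pole $\alpha_j^{-1/2}$ such that $1\le j\le j_0$.
   Context: $t(z)=\sum_{n\in\mathbb Z}t_nz^n$ is an abstract (noncommutative) formal generating series, with no singular behaviour of its own. The double contour integrals are understood as follows: on each pair of circles, $f(z/w)$ and $f(w/z)$ are replaced by their convergent Laurent series on the circle $|z/w|=$ const, respectively $|w/z|=$ const, and the resulting formal series is integrated term by term. The intervals with exponents $\pm\frac12$ mean: $R_1/R_2$ (for the sign $-$), or, for the sign $+$, the same condition with $R_1/R_2$ replaced by its inverse; i.e. $[1,|\alpha_1|^{\pm1/2}[$ stands for $1\le R_1/R_2<|\alpha_1|^{-1/2}$ or $|\alpha_1|^{1/2}<R_1/R_2\le1$, and $]|\alpha_{j_0}|^{\pm1/2},|\alpha_{j_0+1}|^{\pm1/2}[$ stands for $|\alpha_{j_0}|^{-1/2}<R_1/R_2<|\alpha_{j_0+1}|^{-1/2}$ or $|\alpha_{j_0+1}|^{1/2}<R_1/R_2<|\alpha_{j_0}|^{1/2}$.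 *)

(* Defs.v *)
From HB Require Import structures.
From mathcomp Require Import all_boot all_order all_algebra.
From mathcomp Require Import complex.
From mathcomp Require Import all_classical all_reals all_analysis.
Set Implicit Arguments.
Unset Strict Implicit.
Unset Printing Implicit Defensive.
Import Order.TTheory GRing.Theory Num.Theory numFieldNormedType.Exports.

Local Open Scope ring_scope.
Local Open Scope complex_scope.
Local Open Scope classical_set_scope.

(* R[i] receives the topology of its norm from its regular module R[i]^o, as
   the library does for abstract numFieldTypes; [derivable f z 1] is then
   complex differentiability at z. *)
HB.instance Definition _ (R : rcfType) := NormedModule.copy R[i] R[i]^o.

(* The free associative K-algebra on letters t_n (n : int), completed so that
   all formal (infinite) linear combinations of words are allowed:
   [s u] is the coefficient in [s] of the word t_{u_1} t_{u_2} ... t_{u_r}.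
   Modes obeying relations live in the image of an algebra morphism out of
   [ncseries K] (typically a quotient by a two-sided ideal), where the images
   of formal infinite sums are taken as the infinite sums. *)
Definition ncseries (K : Type) := seq int -> K.

Section NCSeries.
Variable K : comNzRingType.

HB.instance Definition _ := GRing.Lmodule.copy (ncseries K) (seq int -> K^o).

Definition ncone : ncseries K := fun u => (u == [::])%:R.

Definition ncmul (f g : ncseries K) : ncseries K :=
  fun u => \sum_(0 <= i < (size u).+1) f (take i u) * g (drop i u).

Lemma ncmulA : associative ncmul.
Proof.
move=> f g h; apply/funext => u; rewrite /ncmul; set n := size u.
pose T j i := f (take j u) * (g (drop j (take i u)) * h (drop i u)).
transitivity (\sum_(0 <= j < n.+1) \sum_(0 <= i < n.+1 | (j <= i)%N) T j i).
  apply: eq_big_nat => j /andP[_]; rewrite ltnS => jn.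
  rewrite size_drop -/n mulr_sumr -(big_nat_widenl _ _ _ xpredT) //=.
  rewrite -[in RHS](add0n j) big_addn subSn // add0n.
  by apply: eq_bigr => i _; rewrite /T drop_drop take_drop.
rewrite (exchange_big_dep xpredT) //=.
apply: eq_big_nat => i /andP[_]; rewrite ltnS => iin.
rewrite size_take_min -/n (minn_idPl iin) mulr_suml.
rewrite [RHS](big_nat_widen 0 i.+1 n.+1) //; apply: eq_big => j //.
by move=> ji; rewrite /T (take_takel _ ji) mulrA.
Qed.

Lemma ncmul1 : left_id ncone ncmul.
Proof.
move=> f; apply/funext => u; rewrite /ncmul big_nat_recl //= big1_seq.
  by rewrite take0 drop0 /ncone eqxx mul1r addr0.
move=> i; rewrite mem_index_iota /= => iu; rewrite /ncone.
by case: u iu => //= x u _; rewrite mul0r.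
Qed.

Lemma nc1mul : right_id ncone ncmul.
Proof.
move=> f; apply/funext => u; rewrite /ncmul big_nat_recr //= big1_seq.
  by rewrite take_size drop_size /ncone eqxx mulr1 add0r.
move=> i; rewrite mem_index_iota /= => iu; rewrite /ncone.
by rewrite -size_eq0 size_drop subn_eq0 leqNgt iu mulr0.
Qed.

Lemma ncmulDl : left_distributive ncmul +%R.
Proof.
move=> f g h; apply/funext => u.
rewrite [RHS](_ : _ = ncmul f h u + ncmul g h u) // /ncmul -big_split /=.
by apply: eq_bigr => i _; rewrite -mulrDl.
Qed.

Lemma ncmulDr : right_distributive ncmul +%R.
Proof.
move=> f g h; apply/funext => u.
rewrite [RHS](_ : _ = ncmul f g u + ncmul f h u) // /ncmul -big_split /=.
by apply: eq_bigr => i _; rewrite -mulrDr.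
Qed.

Lemma ncone_neq0 : ncone != 0.
Proof. by apply/eqP => /(congr1 (@^~ [::])) /eqP; rewrite /ncone eqxx oner_eq0. Qed.

HB.instance Definition _ := GRing.Zmodule_isNzRing.Build (ncseries K)
  ncmulA ncmul1 nc1mul ncmulDl ncmulDr ncone_neq0.

Lemma ncscaleAl (a : K) (f g : ncseries K) : a *: (f * g) = (a *: f) * g.
Proof.
apply/funext => u.
rewrite [LHS](_ : _ = a * ncmul f g u) // /ncmul mulr_sumr.
by apply: eq_bigr => i _; rewrite [LHS]mulrA.
Qed.

HB.instance Definition _ := GRing.Lmodule_isLalgebra.Build K (ncseries K) ncscaleAl.

Lemma ncscaleAr (a : K) (f g : ncseries K) : a *: (f * g) = f * (a *: g).
Proof.
apply/funext => u.
rewrite [LHS](_ : _ = a * ncmul f g u) // /ncmul mulr_sumr.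
by apply: eq_bigr => i _; rewrite [LHS]mulrCA.
Qed.

HB.instance Definition _ := GRing.Lalgebra_isAlgebra.Build K (ncseries K) ncscaleAr.

Definition tmode (n : int) : ncseries K := fun u => (u == [:: n])%:R.

(* Formal infinite sum, computed word by word. It is meant for families in
   which each word has a nonzero coefficient in finitely many members only
   (\sum_(i \in _) is 0 on a family with infinite support). *)
Definition ncsum (I : choiceType) (F : I -> ncseries K) : ncseries K :=
  fun u => \sum_(i \in [set: I]) F i u.

(* F : int -> int -> ncseries K stands for \sum_(a, b) F a b z^a w^b;
   t(z) = \sum_n t_n z^n, since t_n is the integral of z^(-n) t(z) dz/(2 i pi z). *)
Definition tz_tw (a b : int) : ncseries K := tmode a * tmode b.
Definition tw_tz (a b : int) : ncseries K := tmode b * tmode a.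

(* Products of F with \sum_k c_k (z/w)^k, resp. \sum_k c_k (w/z)^k. *)
Definition mul_z_over_w (c : int -> K) (F : int -> int -> ncseries K) (a b : int) :=
  ncsum (fun k : int => c k *: F (a - k) (b + k)).
Definition mul_w_over_z (c : int -> K) (F : int -> int -> ncseries K) (a b : int) :=
  ncsum (fun k : int => c k *: F (a + k) (b - k)).

(* Term by term integral of z^(-n) w^(-m) F(z, w) dz/(2 i pi z) dw/(2 i pi w). *)
Definition formal_oint (n m : int) (F : int -> int -> ncseries K) := F n m.

End NCSeries.

Section Meromorphic.
Variable R : realType.
Implicit Types (f g h : R[i] -> R[i]) (z : R[i]).

Definition holomorphic_at f z := \forall w \near z, derivable f w 1.

Definition has_pole f z (k : nat) := (0 < k)%N /\
  exists h, [/\ holomorphic_at h z, h z != 0 &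
                \forall w \near z^', f w = h w / (w - z) ^+ k].

(* The values of a meromorphic function at its poles are irrelevant. *)
Definition meromorphic f :=
  forall z, holomorphic_at f z \/ exists k, has_pole f z k.

Definition meromorphic_in_square f :=
  exists2 g, meromorphic g & forall x, f x = g (x ^+ 2).

(* h with its (removable) singularity at z removed. *)
Definition regularized h z : R[i] -> R[i] :=
  fun w => if w == z then lim (h x @[x --> z^']) else h w.

Definition taylor_coef f (k : nat) : R[i] := (f^`(k))%classic 0 / k`!%:R.

(* \sum_k c_k x^k converges to f x on an open annulus containing the circle
   |x| = rho; such a c is unique, so that
   laurent_coef below is well defined where an expansion exists. *)
Definition laurent_expansion f (rho : R) (c : int -> R[i]) :=
  exists r1 r2 : R, [/\ 0 <= r1, r1 < rho, rho < r2 &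
    forall x, r1 < Normc.normc x < r2 -> exists s1 s2 : R[i],
      [/\ series (fun k : nat => c k%:Z * x ^+ k) @ \oo --> s1,
          series (fun k : nat => c (- k.+1%:Z) * x ^- k.+1) @ \oo --> s2 &
          f x = s1 + s2]].

Definition laurent_coef f (rho : R) : int -> R[i] :=
  xget (fun=> 0) [set c | laurent_expansion f rho c].

(* [f(z/w) t(z) t(w) - f(w/z) t(w) t(z)], with |z| = r and |w| = s. *)
Definition exchange_bracket f (r s : R) (a b : int) : ncseries R[i] :=
  mul_z_over_w (laurent_coef f (r / s)) (@tz_tw R[i]) a b
  - mul_w_over_z (laurent_coef f (s / r)) (@tw_tz R[i]) a b.

Definition exchange_integral f (R1 R2 : R) (n m : int) : ncseries R[i] :=
  formal_oint n m (exchange_bracket f R1 R2)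
  + formal_oint n m (exchange_bracket f R2 R1).

Definition exchange_term (n m l : int) : ncseries R[i] :=
  tmode R[i] (n - 2 * l) * tmode R[i] (m + 2 * l)
  - tmode R[i] (m - 2 * l) * tmode R[i] (n + 2 * l).

(* The poles are indexed by 1 <= j <= n if N = Some n, by all j >= 1 if N = None. *)
Definition pole_index (N : option nat) (j : nat) : bool :=
  (0 < j)%N && (if N is Some n then (j <= n)%N else true).

(* |alpha_j|^(-1/2), and +oo past the last pole if there are finitely many. *)
Definition pole_radius (N : option nat) (alpha : nat -> R[i]) (j : nat) : \bar R :=
  if pole_index N j then ((Num.sqrt (Normc.normc (alpha j)))^-1)%:E else +oo%E.

(* In the sequel [a j] is a square root of 1 / alpha_j, written alpha_j^(-1/2);
   so alpha_j^(l - 1/2) is alpha_j ^ l * a j, for the same branch. *)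
Definition simple_pole_contribution f (alpha a : nat -> R[i]) (l : int) (j : nat) : R[i] :=
  let h x := (1 - alpha j * x ^+ 2) * f x in
  - (1 / 2) * alpha j ^ l * regularized h (a j) (a j).

Definition double_pole_contribution f (alpha a : nat -> R[i]) (l : int) (j : nat) : R[i] :=
  let h x := (1 - alpha j * x ^+ 2) ^+ 2 * f x in
  - (1 / 2) * (l + 1)%:~R * alpha j ^ l * regularized h (a j) (a j)
  + 1 / 4 * (alpha j ^ l * a j) * ((regularized h (a j))^`())%classic (a j).

Definition shifted_coef f (alpha a : nat -> R[i]) (j0 : nat) (l : int) : R[i] :=
  (if l is Posz k then taylor_coef f (2 * k)%N else 0)
  + \sum_(1 <= j < j0.+1 | `[< has_pole f (a j) 1 >])
      simple_pole_contribution f alpha a l j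
  + \sum_(1 <= j < j0.+1 | `[< has_pole f (a j) 2 >])
      double_pole_contribution f alpha a l j.

End Meromorphic.

(* Main.v *)
Require Import Defs.
From HB Require Import structures.
From mathcomp Require Import all_boot all_order all_algebra.
From mathcomp Require Import complex.
From mathcomp Require Import all_classical all_reals all_analysis.
From mathcomp Require Import ring lra.
Import Order.TTheory GRing.Theory Num.Theory numFieldNormedType.Exports.
Set Implicit Arguments.
Unset Strict Implicit.
Unset Printing Implicit Defensive.
Local Open Scope ring_scope.
Local Open Scope complex_scope.
Local Open Scope classical_set_scope.

(** The two brackets involve the Laurent coefficients of [f] on the circle of
    radius [R1 / R2] and on the circle of the inverse radius. Let [c] and [d]
    denote them. Collecting words, the exchange integral is the formal sum over
    [k] of [(c k + d k) (t_(n-k) t_(m+k) - t_(m-k) t_(n+k))]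
    ([exchange_integralE]). It remains to see that [(c + d) / 2] is supported on
    the even integers, where it takes the values [f_l], respectively
    [f_l^(j0)]; the factor [2] is harmless for the image under [phi].

    Write [f x = g (x ^ 2)]. The poles of [g] are the [1 / alpha_j], with the
    orders of the poles of [f] ([pole_location]). Subtracting from [g] its
    principal parts at the first [j0] poles leaves a function that is holomorphic
    up to the next pole, hence a Taylor series [sum b_l w^l] there
    ([remove_poles]). A principal part [A / (1 - al w) + B / (1 - al w)^2] has
    the expansion [sum_(l >= 0) P_l w^l] inside its pole and
    [- sum_(l < 0) P_l w^l] outside, with the same
    [P_l = al^l A + (l + 1) al^l B] ([principal_part_inner],
    [principal_part_outer]). Therefore one of the circles, which lies inside all
    poles, has the coefficients [b_l + sum_j P_l] for [l >= 0] and [0] for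
    [l < 0], and the former are the [f_l]; the other circle has [b_l] for
    [l >= 0] and [- sum_j P_l] for [l < 0] ([circle_expansions]). Half the sum is
    [f_l - (1 / 2) sum_j P_l] for every integer [l], with [f_l = 0] for [l < 0]
    ([average_coef]), and [pole_data] recognizes [- P_l / 2] in the contributions
    of the statement. When both circles lie before the first pole there is
    nothing to subtract, and both sequences are [f_l].

    The complex analysis behind this is Taylor's theorem on a whole disc for a
    function that is merely complex differentiable ([taylor_theorem]) and the
    uniqueness of Laurent expansions ([laurent_expansion_unique]). Contour
    integrals are limits of trapezoid sums defined by recursion on dyadic
    subdivisions. Such sums are additive under bisection by construction and
    exact on affine functions ([psum_affine]), so that the subdivision argument
    of Goursat applies to the sums themselves ([goursat]). Contracting a circle
    to a point gives Cauchy's theorem ([circle_integral_eq0]), then Cauchy's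
    formula and the Taylor series; pairing with powers of [w], whose integrals
    vanish by symmetry except for [1 / w] ([cint_monomial_eq0],
    [cint_inv_neq0]), gives uniqueness. *)

(** * The modulus with values in the reals *)

Section Modulus.
Variable R : realType.
Implicit Types x y z w : R[i].

(** The norm of [R[i]] takes its values in [R[i]]; estimates are made in [R]. *)
Definition cmod z : R := Normc.normc z.

Lemma cmod_norm z : `|z| = (cmod z)%:C. Proof. by []. Qed.

Lemma cmod_ge0 z : 0 <= cmod z.
Proof. by case: z => a b; rewrite /cmod /= sqrtr_ge0. Qed.

Lemma cmod0 : cmod 0 = 0. Proof. exact: Normc.normc0. Qed.

Lemma cmod1 : cmod 1 = 1. Proof. exact: Normc.normc1. Qed.

Lemma cmod_eq0 z : cmod z = 0 -> z = 0. Proof. exact: Normc.eq0_normc. Qed.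

Lemma cmod_gt0 z : (0 < cmod z) = (z != 0).
Proof.
rewrite lt_def cmod_ge0 andbT; congr negb; apply/eqP/eqP; first exact: cmod_eq0.
by move=> ->; exact: cmod0.
Qed.

Lemma cmodM x y : cmod (x * y) = cmod x * cmod y. Proof. exact: Normc.normcM. Qed.

Lemma cmodN z : cmod (- z) = cmod z. Proof. exact: normcN. Qed.

Lemma cmodD x y : cmod (x + y) <= cmod x + cmod y. Proof. exact: le_normcD. Qed.

Lemma cmodB x y : cmod (x - y) <= cmod x + cmod y.
Proof. by rewrite -(cmodN y) cmodD. Qed.

Lemma cmod_sym x y : cmod (x - y) = cmod (y - x).
Proof. by rewrite -cmodN opprB. Qed.

Lemma cmod_triangle x y z : cmod (x - z) <= cmod (x - y) + cmod (y - z).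
Proof. by apply: le_trans (cmodD _ _); rewrite addrA subrK. Qed.

Lemma cmodV z : cmod z^-1 = (cmod z)^-1. Proof. exact: Normc.normcV. Qed.

Lemma cmodX z n : cmod (z ^+ n) = cmod z ^+ n.
Proof. by elim: n => [|n IH]; rewrite ?expr0 ?cmod1 // !exprS cmodM IH. Qed.

Lemma cmodr (a : R) : cmod a%:C = `|a|.
Proof. by rewrite /cmod /= expr0n addr0 sqrtr_sqr. Qed.

Lemma cmodn (n : nat) : cmod n%:R = n%:R.
Proof.
have -> : n%:R = (n%:R)%:C :> R[i] by rewrite rmorph_nat.
by rewrite cmodr ger0_norm.
Qed.

Lemma gt0_realC (e : R[i]) : 0 < e -> exists2 e' : R, 0 < e' & e = e'%:C.
Proof.
case: e => a b; rewrite ltcE /= => /andP[/eqP -> a0]; exists a => //.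
Qed.

End Modulus.

(** * Limits and complex derivatives through the modulus *)

Section Bridge.
Variable R : realType.
Implicit Types (x y z w : R[i]) (F : R[i] -> R[i]).

Lemma nbhs_cmodP z (P : set R[i]) :
  nbhs z P <-> exists2 e : R, 0 < e & forall w, cmod (w - z) < e -> P w.
Proof.
split.
  move=> /nbhs_normP[e /= /gt0_realC[e' e0 ->] H].
  exists e' => // w wz; apply: H.
  by rewrite /ball_ /= distrC cmod_norm ltcR.
case=> e e0 H; apply/nbhs_normP; exists e%:C; first by rewrite /= ltcR.
by move=> w; rewrite /ball_ /= distrC cmod_norm ltcR => /H.
Qed.

Lemma dnbhs_cmodP z (P : set R[i]) :
  nbhs z^' P <-> exists2 e : R, 0 < e &
    forall w, w != z -> cmod (w - z) < e -> P w.
Proof.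
rewrite [X in X <-> _](_ : _ = nbhs z [set w | w != z -> P w]) // (nbhs_cmodP z).
by split=> -[e e0 H]; exists e => // w ? ?; exact: H.
Qed.

Lemma cvg_cmodP (T : Type) (D : set_system T) (u : T -> R[i]) l :
  Filter D ->
  (u x @[x --> D] --> l) <-> forall e : R, 0 < e -> \forall x \near D, cmod (u x - l) < e.
Proof.
move=> FD; split.
  move=> ul e e0; move/cvgrPdist_lt: ul => /(_ e%:C).
  rewrite ltcR => /(_ e0); apply: filterS => x.
  by rewrite distrC cmod_norm ltcR.
move=> H; apply/cvgrPdist_lt => e /gt0_realC[e' e0 ->].
apply: filterS (H _ e0) => x; by rewrite distrC cmod_norm ltcR.
Qed.

Lemma cvg_seqP (u : nat -> R[i]) l :
  (u @ \oo --> l) <-> forall e : R, 0 < e -> exists n0, forall n, (n0 <= n)%N -> cmod (u n - l) < e.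
Proof.
rewrite cvg_cmodP; split=> H e /H.
  by case=> n0 _ Hn; exists n0 => n; apply: Hn.
by case=> n0 Hn; exists n0.
Qed.

(** Differentiability in division-free form, with a non-strict bound: it makes
    sense at [w = z] and survives composition without case analysis. *)
Definition cdiff F z d := forall e : R, 0 < e -> exists2 r : R, 0 < r &
  forall w, cmod (w - z) < r -> cmod (F w - F z - d * (w - z)) <= e * cmod (w - z).

Lemma derive1_cdiff F z : derivable F z 1 -> cdiff F z (F^`() z)%classic.
Proof.
move=> dF e e0; rewrite derive1E.
have := dF; rewrite /derivable /derive.
set q := (fun h : R[i] => _) => /cvg_cmodP H.
have := H _ e0 => /dnbhs_cmodP[r r0 Hr]; exists r => // w wz.
have [->|wz0] := eqVneq w z; first by rewrite !subrr mulr0 subrr cmod0 mulr0.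
have hn0 : w - z != 0 by rewrite subr_eq0.
have := Hr (w - z) hn0; rewrite subr0 => /(_ wz).
set D := lim _.
rewrite /q /= scaler1 subrK => Hq.
have -> : F w - F z - D * (w - z) = ((w - z)^-1 *: (F w - F z) - D) * (w - z).
  by rewrite mulrBl; congr (_ - _); rewrite [_ *: _]mulrC mulfVK.
by rewrite cmodM ler_pM2r ?cmod_gt0 // ltW.
Qed.

Lemma cdiff_is_derive F z d : cdiff F z d -> is_derive z 1 F d.
Proof.
move=> H.
suff C : (fun h : R[i] => h^-1 *: ((F \o shift z) (h *: 1) - F z)) @ 0^' --> d.
  split; first by apply/cvg_ex; exists d.
  exact: cvg_lim C.
apply/cvg_cmodP => e e0; apply/dnbhs_cmodP.
have e20 : 0 < e / 2 by rewrite divr_gt0.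
have [r r0 Hr] := H _ e20; exists r => // h h0; rewrite subr0 => hr /=.
have := Hr (h + z); rewrite addrK => /(_ hr) Hh.
have -> : h^-1 *: (F (h *: 1 + z) - F z) - d = (F (h + z) - F z - d * h) / h.
  rewrite [h *: 1]mulr1 [_ *: _]mulrC mulrBl mulrBl; congr (_ - _).
    by rewrite mulrBl.
  by rewrite mulfK.
rewrite cmodM cmodV ltr_pdivrMr ?cmod_gt0 //; apply: le_lt_trans Hh _.
rewrite ltr_pM2r ?cmod_gt0 //; lra.
Qed.

Lemma cdiff_derivable F z d : cdiff F z d -> derivable F z 1.
Proof. by case/cdiff_is_derive. Qed.

Lemma cdiff_derive1 F z d : cdiff F z d -> (F^`() z)%classic = d.
Proof. by case/cdiff_is_derive => dF dFd; rewrite derive1E. Qed.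

Lemma cdiff_continuous F z d : cdiff F z d -> forall e : R, 0 < e ->
  exists2 r : R, 0 < r & forall w, cmod (w - z) < r -> cmod (F w - F z) < e.
Proof.
move=> H e e0; have [r r0 Hr] := H _ ltr01.
have D0 : 0 < 1 + cmod d by rewrite ltr_pwDl ?cmod_ge0.
exists (Num.min r (e / (1 + cmod d))); first by rewrite lt_min r0 divr_gt0.
move=> w; rewrite lt_min => /andP[/Hr Hw we].
rewrite -(subrK (d * (w - z)) (F w - F z)); apply: le_lt_trans (cmodD _ _) _.
rewrite cmodM; apply: (@le_lt_trans _ _ ((1 + cmod d) * cmod (w - z))).
  by rewrite mulrDl lerD2r.
by rewrite mulrC -ltr_pdivlMr.
Qed.

End Bridge.

(** * Bisection *)

Section Bisection.
Variable R : realType.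

Lemma nested_point (x s : nat -> R) :
  (forall n, x n <= x n.+1) -> (forall n, x n.+1 + s n.+1 <= x n + s n) ->
  (forall n, 0 <= s n) -> exists x0, forall n, x n <= x0 <= x n + s n.
Proof.
move=> xS sS s0.
have x_homo n k : x n <= x (n + k)%N.
  by elim: k => [|k IH]; rewrite ?addn0 ?addnS //; exact: le_trans IH (xS _).
have s_homo n k : x (n + k)%N + s (n + k)%N <= x n + s n.
  by elim: k => [|k IH]; rewrite ?addn0 ?addnS //; exact: le_trans (sS _) IH.
have xs n m : x n <= x m + s m.
  apply: le_trans (x_homo n m) _; apply: le_trans (s_homo m n); rewrite addnC.
  by rewrite lerDl.
exists (sup (range x)) => n; apply/andP; split.
  apply: ub_le_sup; last by exists n.
  by exists (x 0%N + s 0%N) => _ [m _ <-].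
apply: ge_sup; first by exists (x n); exists n.
by move=> _ [m _ <-].
Qed.

Lemma halfpow_small (s d : R) : 0 < d -> exists n, s / 2 ^+ n < d.
Proof.
move=> d0; exists (Num.truncn (`|s| / d)).+1.
rewrite ltr_pdivrMr ?exprn_gt0 //; apply: le_lt_trans (ler_norm _) _.
rewrite mulrC -ltr_pdivrMr //; apply: lt_le_trans (truncnS_gt _) _.
rewrite -natrX ler_nat ltnW // ltn_expl //.
Qed.

(** If [P] fails for the whole square, it fails for one of its quarters, hence
    for a nested sequence of squares whose common point contradicts the local
    hypothesis. This is how compactness enters all that follows. *)
Lemma square_bisection (P : R -> R -> R -> Prop) (X Y S : R) :
  (forall x y s, 0 < s -> P x y (s / 2) -> P (x + s / 2) y (s / 2) ->
     P x (y + s / 2) (s / 2) -> P (x + s / 2) (y + s / 2) (s / 2) -> P x y s) ->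
  0 < S ->
  (forall x0 y0, X <= x0 <= X + S -> Y <= y0 <= Y + S ->
     exists2 d : R, 0 < d & forall x y s, 0 < s < d ->
       x <= x0 <= x + s -> y <= y0 <= y + s ->
       X <= x -> x + s <= X + S -> Y <= y -> y + s <= Y + S -> P x y s) ->
  P X Y S.
Proof.
move=> Pquad S0 Ploc; apply: contrapT => nP.
pose bad (t : R * R * R) := 0 < t.2 /\ ~ P t.1.1 t.1.2 t.2.
pose child (t t' : R * R * R) := [/\ t'.2 = t.2 / 2,
  t.1.1 <= t'.1.1, t'.1.1 + t'.2 <= t.1.1 + t.2,
  t.1.2 <= t'.1.2 & t'.1.2 + t'.2 <= t.1.2 + t.2].
have step t : exists t', bad t -> bad t' /\ child t t'.
  have [bt|] := pselect (bad t); last by move=> nb; exists t.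
  case: t bt => [[x y] s] [/= s0 nPt].
  have [[t' [h1 h2]]|H] := pselect (exists t', bad t' /\ child (x, y, s) t').
    by exists t'.
  have s20 : 0 < s / 2 by rewrite divr_gt0.
  have good a b : x <= a -> a + s / 2 <= x + s -> y <= b -> b + s / 2 <= y + s -> P a b (s / 2).
    by move=> *; apply: contrapT => nPab; apply: H; exists (a, b, s / 2).
  by case: nPt; apply: Pquad => //; apply: good; lra.
have [f Hf] := choice step.
pose t n := iter n f (X, Y, S).
have bt n : bad (t n).
  by elim: n => [|n IH] //=; have [] := Hf _ IH.
have ct n : child (t n) (t n.+1) by have [] := Hf _ (bt n).
have tS n : (t n).2 = S / 2 ^+ n.
  elim: n => [|n IH]; first by rewrite expr0 divr1.
  by have [-> _ _ _ _] := ct n; rewrite IH exprSr invfM mulrA.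
have s0 n : 0 <= (t n).2 by have [/ltW] := bt n.
have [x0 Hx0] : exists x0, forall n, (t n).1.1 <= x0 <= (t n).1.1 + (t n).2.
  by apply: (@nested_point (fun n => (t n).1.1) (fun n => (t n).2)) => // n; have [] := ct n.
have [y0 Hy0] : exists y0, forall n, (t n).1.2 <= y0 <= (t n).1.2 + (t n).2.
  by apply: (@nested_point (fun n => (t n).1.2) (fun n => (t n).2)) => // n; have [] := ct n.
have [d d0 Hd] := Ploc x0 y0 (Hx0 0%N) (Hy0 0%N).
have [n Hn] := halfpow_small S d0.
have [tn nPt] := bt n; apply: nPt.
have inside m : [/\ X <= (t m).1.1, (t m).1.1 + (t m).2 <= X + S,
    Y <= (t m).1.2 & (t m).1.2 + (t m).2 <= Y + S].
  elim: m => [|m [a b c e]] //=.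
  have [_ a' b' c' e'] := ct m.
  by split; [exact: le_trans a a'|exact: le_trans b' b|exact: le_trans c c'|exact: le_trans e' e].
have [a b c e] := inside n.
by apply: Hd => //; rewrite tn tS.
Qed.

(** The one-dimensional case: a property of squares blind to the second
    coordinate. *)
Lemma interval_bisection (P : R -> R -> Prop) (X S : R) :
  (forall x s, 0 < s -> P x (s / 2) -> P (x + s / 2) (s / 2) -> P x s) ->
  0 < S ->
  (forall x0, X <= x0 <= X + S ->
     exists2 d : R, 0 < d & forall x s, 0 < s < d -> x <= x0 <= x + s ->
       X <= x -> x + s <= X + S -> P x s) ->
  P X S.
Proof.
move=> Phalf S0 Ploc; apply: (@square_bisection (fun x _ s => P x s) X X S) => //.
  by move=> x y s s0 h1 h2 _ _; exact: Phalf.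
move=> x0 y0 /Ploc[d d0 H] _; exists d => // x y s sd xx _ ? ? _ _; exact: H.
Qed.

End Bisection.

(** * Dyadic trapezoid sums along a curve *)

Section DyadicSums.
Variable R : realType.
Implicit Types (c g h : R -> R[i]) (L M a s : R).

(** A Stieltjes sum for the integral of [g] against [dc] over [[a, a + s]], by
    the trapezoid rule on [2 ^ p] pieces. The recursion on halves makes it
    additive under bisection by definition, as the subdivision arguments
    require. *)
Fixpoint psum c g (p : nat) a s : R[i] :=
  if p is q.+1 then psum c g q a (s / 2) + psum c g q (a + s / 2) (s / 2)
  else (c (a + s) - c a) * ((g a + g (a + s)) / 2).

Definition lipschitz_on c L a s :=
  forall t u, a <= t <= a + s -> a <= u <= a + s -> cmod (c t - c u) <= L * `|t - u|.

Lemma lipschitz_onW c L a s b r : lipschitz_on c L a s ->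
  a <= b -> b + r <= a + s -> lipschitz_on c L b r.
Proof. by move=> H ab bs t u ht hu; apply: H; lra. Qed.

Lemma psumD c g h p a s :
  psum c (fun t => g t + h t) p a s = psum c g p a s + psum c h p a s.
Proof.
elim: p a s => [|p IH] a s /=; first by rewrite -mulrDr -mulrDl addrACA.
by rewrite !IH addrACA.
Qed.

Lemma psumZ c (u : R[i]) g p a s :
  psum c (fun t => u * g t) p a s = u * psum c g p a s.
Proof.
elim: p a s => [|p IH] a s /=; last by rewrite !IH mulrDr.
by rewrite -mulrDr -mulrA mulrCA.
Qed.

Lemma psumB c g h p a s :
  psum c (fun t => g t - h t) p a s = psum c g p a s - psum c h p a s.
Proof.
rewrite psumD -mulN1r -psumZ; congr (_ + psum _ _ _ _ _).
by apply/funext => t; rewrite mulN1r.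
Qed.

Lemma psum_bound c g L M p a s : 0 <= s -> lipschitz_on c L a s ->
  (forall t, a <= t <= a + s -> cmod (g t) <= M) ->
  cmod (psum c g p a s) <= L * s * M.
Proof.
elim: p a s => [|p IH] a s s0 cL gM /=.
  rewrite cmodM; have h1 : a <= a <= a + s by lra.
  have h2 : a <= a + s <= a + s by lra.
  have := cL _ _ h2 h1; rewrite addrAC subrr add0r (ger0_norm s0) => H1.
  apply: ler_pM => //; try exact: cmod_ge0.
  rewrite cmodM cmodV cmodn ler_pdivrMr //.
  by apply: le_trans (cmodD _ _) _; rewrite mulr_natr mulr2n lerD // gM.
apply: le_trans (cmodD _ _) _.
have -> : L * s * M = L * (s / 2) * M + L * (s / 2) * M.
  by rewrite -mulrDl -mulrDr -splitr.
have s20 : 0 <= s / 2 by lra.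
apply: lerD; apply: IH => //.
- by apply: lipschitz_onW cL _ _; lra.
- by move=> t ht; apply: gM; lra.
- by apply: lipschitz_onW cL _ _; lra.
- by move=> t ht; apply: gM; lra.
Qed.

(** The trapezoid rule integrates an affine integrand exactly, whatever the
    curve: the sum telescopes to the increment of a primitive. *)
Lemma psum_affine c (u v : R[i]) p a s :
  psum c (fun t => u + v * c t) p a s =
  (u * c (a + s) + v * c (a + s) ^+ 2 / 2) - (u * c a + v * c a ^+ 2 / 2).
Proof.
elim: p a s => [|p IH] a s /=; last first.
  have tele (x y z : R[i]) : (y - x) + (z - y) = z - x by ring.
  by rewrite !IH -(addrA a) -splitr tele.
by field.
Qed.

Lemma psum_const c (u : R[i]) p a s :
  psum c (fun=> u) p a s = u * (c (a + s) - c a).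
Proof.
transitivity (psum c (fun t => u + 0 * c t) p a s).
  by congr psum; apply/funext => t; rewrite mul0r addr0.
by rewrite psum_affine; ring.
Qed.

(** Continuity of a function of the real parameter of a curve. *)
Definition tcontinuous g := forall t e, 0 < e ->
  exists2 d : R, 0 < d & forall u, `|u - t| < d -> cmod (g u - g t) < e.

(** The oscillation of [p |-> psum c g p] is subadditive under bisection, and
    on a short interval [g] is nearly constant, where the sums are exact. *)
Lemma psum_cauchy c g L a s : 0 < s -> lipschitz_on c L a s -> tcontinuous g ->
  forall e : R, 0 < e -> exists n0, forall p q, (n0 <= p)%N -> (n0 <= q)%N ->
    cmod (psum c g p a s - psum c g q a s) <= e * s.
Proof.
move=> s0 cL gC e e0.
pose P x s := exists n0, forall p q, (n0 <= p)%N -> (n0 <= q)%N ->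
    cmod (psum c g p x s - psum c g q x s) <= e * s.
apply: (@interval_bisection R P) => //.
  move=> x r r0 [n1 H1] [n2 H2]; exists (maxn n1 n2).+1 => -[|p] [|q] //.
  rewrite !ltnS !geq_max => /andP[p1 p2] /andP[q1 q2] /=.
  rewrite opprD addrACA; apply: le_trans (cmodD _ _) _.
  by rewrite [in leRHS](splitr r) mulrDr lerD ?H1 ?H2.
move=> x0 hx0.
pose L' := `|L| + 1; have L'0 : 0 < L' by rewrite ltr_wpDl.
have e'0 : 0 < e / (2 * L') by rewrite divr_gt0 // mulr_gt0.
have [d d0 Hd] := gC x0 _ e'0; exists d => // x r /andP[r0 rd] xx ax xs.
exists 0%N => p q _ _.
have B n : cmod (psum c g n x r - psum c (fun=> g x0) n x r) <= e * r / 2.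
  rewrite -psumB; have := @psum_bound c (fun t => g t - g x0) L' (e / (2 * L')) n x r.
  have -> : L' * r * (e / (2 * L')) = e * r / 2 by field; rewrite gt_eqF.
  apply; first exact: ltW.
    move=> t u ht hu; apply: le_trans (lipschitz_onW cL ax xs ht hu) _.
    apply: ler_wpM2r => //; rewrite /L'; apply: le_trans (ler_norm _) _; lra.
  by move=> t ht; apply/ltW/Hd; rewrite ltr_norml; lra.
have := cmod_triangle (psum c g p x r) (psum c (fun=> g x0) p x r) (psum c g q x r).
have := B p; have := B q; rewrite !psum_const cmod_sym; lra.
Qed.

End DyadicSums.

(** * Goursat's lemma *)

Section Goursat.
Variable R : realType.
Implicit Types (P : R -> R -> R[i]) (G : R[i] -> R[i]).

(** Completeness of [R[i]], from that of [R] by real and imaginary parts. *)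
Lemma cvg_of_cauchy (u : nat -> R[i]) :
  (forall e : R, 0 < e -> exists n0, forall p q, (n0 <= p)%N -> (n0 <= q)%N ->
     cmod (u p - u q) <= e) -> cvg (u @ \oo).
Proof.
move=> H.
have comp (f : R[i] -> R) : (forall x y, `|f x - f y| <= cmod (x - y)) -> cvg ((f \o u) @ \oo).
  move=> fl; apply/cauchy_cvgP/cauchy_exP => e e0.
  have e20 : 0 < e / 2 by rewrite divr_gt0.
  have [n0 Hn] := H _ e20; exists (f (u n0)); exists n0 => // n /= n0n.
  rewrite /ball /=; apply: le_lt_trans (fl _ _) _.
  by apply: le_lt_trans (Hn _ _ (leqnn _) n0n) _; lra.
have /cvg_ex[a /cvgrPdist_lt Ha] : cvg ((@complex.Re R \o u) @ \oo).
  apply: comp => -[a b] [a' b'] /=; rewrite /cmod /= -sqrtr_sqr ler_wsqrtr //.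
  by rewrite lerDl sqr_ge0.
have /cvg_ex[b /cvgrPdist_lt Hb] : cvg ((@complex.Im R \o u) @ \oo).
  apply: comp => -[a' b] [a'' b'] /=; rewrite /cmod /= -sqrtr_sqr ler_wsqrtr //.
  by rewrite lerDr sqr_ge0.
apply/cvg_ex; exists (a +i* b); apply/cvg_cmodP => e e0.
have e20 : 0 < e / 2 by rewrite divr_gt0.
near=> n.
have -> : u n - a +i* b = (complex.Re (u n) - a)%:C + (complex.Im (u n) - b)%:C * 'i.
  by case: (u n) => x y; apply/eqP; rewrite eq_complex /=; apply/andP; split; apply/eqP; ring.
apply: le_lt_trans (cmodD _ _) _; rewrite cmodM !cmodr.
have -> : cmod 'i = 1 :> R by rewrite /cmod /= expr0n expr1n add0r sqrtr1.
rewrite mulr1 (splitr e) ltrD //; rewrite distrC.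
  by near: n; exact: Ha.
by near: n; exact: Hb.
Unshelve. all: by end_near. Qed.

(** The integral of [g] against [dc] over the unit interval. *)
Definition pint (c g : R -> R[i]) : R[i] := lim (psum c g p 0 1 @[p --> \oo]).

Lemma psum_cvg (c g : R -> R[i]) L : lipschitz_on c L 0 1 -> tcontinuous g ->
  psum c g p 0 1 @[p --> \oo] --> pint c g.
Proof.
move=> cL gC; apply: cvg_of_cauchy => e e0.
have [n0 H] := psum_cauchy ltr01 cL gC e0; exists n0 => p q p0 q0.
by have := H p q p0 q0; rewrite mulr1.
Qed.

(** Dyadic sum of [G(w) dw] along the image under [P] of the positively oriented
    boundary of the square of side [s] with lower left corner [(x, y)]. *)
Definition boundary_sum P G p x y s : R[i] :=
  psum (P^~ y) (fun t => G (P t y)) p x s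
  + psum (P (x + s)) (fun t => G (P (x + s) t)) p y s
  - psum (P^~ (y + s)) (fun t => G (P t (y + s))) p x s
  - psum (P x) (fun t => G (P x t)) p y s.

Lemma boundary_sum_quarters P G p x y s :
  boundary_sum P G p.+1 x y s =
  boundary_sum P G p x y (s / 2) + boundary_sum P G p (x + s / 2) y (s / 2)
  + boundary_sum P G p x (y + s / 2) (s / 2)
  + boundary_sum P G p (x + s / 2) (y + s / 2) (s / 2).
Proof.
rewrite /boundary_sum /= -!(addrA x) -!(addrA y) -!splitr; ring.
Qed.

(** The property that the boundary sums are eventually at most [e * s ^ 2] passes
    from the quarters of a square to the square. Near a point where [G] is
    differentiable it holds because the affine part of [G] contributes exactly
    nothing to a closed polygon, while the rest is [o(s)] along edges of length
    [O(s)]. *)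
Lemma goursat P G L X Y S : 0 < L -> 0 < S ->
  (forall t, Y <= t <= Y + S -> lipschitz_on (P^~ t) L X S) ->
  (forall x, X <= x <= X + S -> lipschitz_on (P x) L Y S) ->
  (forall x t, X <= x <= X + S -> Y <= t <= Y + S -> exists d, cdiff G (P x t) d) ->
  forall e : R, 0 < e -> exists n0, forall p, (n0 <= p)%N ->
    cmod (boundary_sum P G p X Y S) <= e * S ^+ 2.
Proof.
move=> L0 S0 PX PY GD e e0.
pose Q x y s := exists n0, forall p, (n0 <= p)%N ->
    cmod (boundary_sum P G p x y s) <= e * s ^+ 2.
apply: (@square_bisection R Q) => //.
  move=> x y s s0 [n1 H1] [n2 H2] [n3 H3] [n4 H4].
  exists (maxn (maxn n1 n2) (maxn n3 n4)).+1 => -[|p] //.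
  rewrite ltnS !geq_max => /andP[/andP[p1 p2] /andP[p3 p4]].
  rewrite boundary_sum_quarters.
  have -> : e * s ^+ 2 = e * (s / 2) ^+ 2 + e * (s / 2) ^+ 2 + e * (s / 2) ^+ 2 + e * (s / 2) ^+ 2.
    by field.
  do 3 (apply: le_trans (cmodD _ _) _; apply: lerD; last by auto).
  by auto.
move=> x0 y0 hx0 hy0.
(* Compare [G] with its affine approximation [A + D * w] at [w0]. *)
have [D HD] := GD _ _ hx0 hy0.
set w0 := P x0 y0 in HD *.
pose e' := e / (8 * L ^+ 2).
have e'0 : 0 < e' by rewrite divr_gt0 // mulr_gt0 // exprn_gt0.
have [r r0 Hr] := HD _ e'0.
exists (r / (2 * L)); first by rewrite divr_gt0 // mulr_gt0.
move=> x y s /andP[s0 sr] xx yy Xx xS Yy yS.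
have sr' : 2 * L * s < r by rewrite mulrC -ltr_pdivlMr // mulr_gt0.
exists 0%N => p _.
pose A := G w0 - D * w0.
pose E w := G w - (A + D * w).
have near_w0 a b : x <= a <= x + s -> y <= b <= y + s -> cmod (P a b - w0) <= 2 * L * s.
  move=> ha hb; apply: le_trans (cmod_triangle _ (P x0 b) _) _.
  have h1 : cmod (P a b - P x0 b) <= L * `|a - x0|.
    by apply: PX; lra.
  have h2 : cmod (P x0 b - w0) <= L * `|b - y0|.
    by apply: PY; lra.
  have h3 : L * `|a - x0| <= L * s by rewrite ler_pM2l // ler_norml; lra.
  have h4 : L * `|b - y0| <= L * s by rewrite ler_pM2l // ler_norml; lra.
  lra.
have E_small a b : x <= a <= x + s -> y <= b <= y + s -> cmod (E (P a b)) <= e' * (2 * L * s).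
  move=> ha hb; have H := near_w0 _ _ ha hb.
  have -> : E (P a b) = G (P a b) - G w0 - D * (P a b - w0) by rewrite /E /A; ring.
  apply: le_trans (Hr _ (le_lt_trans H sr')) _.
  by rewrite ler_pM2l.
have split_edge (c : R -> R[i]) z :
    psum c (fun t => G (c t)) p z s =
    psum c (fun t => A + D * c t) p z s + psum c (fun t => E (c t)) p z s.
  by rewrite -psumD; congr psum; apply/funext => t; rewrite /E addrC subrK.
have -> : boundary_sum P G p x y s = boundary_sum P E p x y s.
  rewrite /boundary_sum (split_edge (P^~ y)) (split_edge (P (x + s)))
    (split_edge (P^~ (y + s))) (split_edge (P x)) !psum_affine.
  ring.
have B c z : (forall t, z <= t <= z + s -> cmod (E (c t)) <= e' * (2 * L * s)) ->
    lipschitz_on c L z s -> cmod (psum c (fun t => E (c t)) p z s) <= e * s ^+ 2 / 4.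
  move=> hE cL; have := psum_bound p (ltW s0) cL hE.
  suff -> : L * s * (e' * (2 * L * s)) = e * s ^+ 2 / 4 by [].
  by rewrite /e'; field; rewrite gt_eqF.
have -> : e * s ^+ 2 = e * s ^+ 2 / 4 + e * s ^+ 2 / 4 + e * s ^+ 2 / 4 + e * s ^+ 2 / 4 by field.
have xin : x <= x <= x + s by lra.
have xsin : x <= x + s <= x + s by lra.
have yin : y <= y <= y + s by lra.
have ysin : y <= y + s <= y + s by lra.
rewrite /boundary_sum; apply: le_trans (cmodB _ _) _; apply: lerD; last first.
  by apply: B => [t ht|]; [exact: E_small|apply: lipschitz_onW (PY _ _) _ _; lra].
apply: le_trans (cmodB _ _) _; apply: lerD; last first.
  by apply: (B (P^~ (y + s))) => [t ht|]; [exact: E_small|apply: lipschitz_onW (PX _ _) _ _; lra].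
apply: le_trans (cmodD _ _) _; apply: lerD; last first.
  by apply: B => [t ht|]; [exact: E_small|apply: lipschitz_onW (PY _ _) _ _; lra].
by apply: (B (P^~ y)) => [t ht|]; [exact: E_small|apply: lipschitz_onW (PX _ _) _ _; lra].
Qed.

End Goursat.

(** * Cauchy's theorem for a circle *)

Section Circle.
Variable R : realType.
Implicit Types (r t u : R) (G : R[i] -> R[i]).

Lemma cmod_small (z : R[i]) : (forall e : R, 0 < e -> cmod z <= e) -> z = 0.
Proof.
move=> H; apply: cmod_eq0; apply/eqP; rewrite eq_le cmod_ge0 andbT.
by apply/ler_addgt0Pl => e e0; rewrite addr0 H.
Qed.

Lemma lipschitz1 (f df : R -> R) : (forall x : R, is_derive x 1 f (df x)) ->
  (forall x, `|df x| <= 1) -> forall x y, `|f x - f y| <= `|x - y|.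
Proof.
move=> fdf df1.
have main x y : x <= y -> `|f y - f x| <= `|y - x|.
  move=> xy.
  have fC : {within `[x, y], continuous f}.
    by apply: derivable_within_continuous => z _; case: (fdf z).
  have [c _ ->] := MVT_segment xy (fun z _ => fdf z) fC.
  by rewrite normrM ler_piMl.
move=> x y; have [/main|/ltW/main //] := leP x y.
by rewrite distrC (distrC x).
Qed.

Definition cis t : R[i] := cos (2 * pi * t) +i* sin (2 * pi * t).

Lemma cis0 : cis 0 = 1. Proof. by rewrite /cis mulr0 cos0 sin0. Qed.

Lemma cis1 : cis 1 = 1.
Proof. by rewrite /cis mulr1 mulr_natl cos2pi sin2pi. Qed.

Lemma cisD t u : cis (t + u) = cis t * cis u.
Proof.
rewrite /cis mulrDr cosD sinD; apply/eqP; rewrite eq_complex /=.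
by apply/andP; split; apply/eqP; ring.
Qed.

Lemma cmod_cis t : cmod (cis t) = 1.
Proof. by rewrite /cmod /cis /= cos2Dsin2 sqrtr1. Qed.

Lemma cis_neq0 t : cis t != 0.
Proof. by rewrite -cmod_gt0 cmod_cis. Qed.

Lemma cisX t n : cis t ^+ n = cis (t * n%:R).
Proof.
elim: n => [|n IH]; first by rewrite expr0 mulr0 cis0.
by rewrite exprS IH -cisD mulrS mulrDr mulr1.
Qed.

(** Twice the Lipschitz constant [2 * pi] of each coordinate. *)
Definition cis_lip : R := 4 * pi.

Lemma cis_lip_gt0 : 0 < cis_lip. Proof. by rewrite mulr_gt0 ?pi_gt0. Qed.

Lemma cis_lipschitz t u : cmod (cis t - cis u) <= cis_lip * `|t - u|.
Proof.
have lc : `|cos (2 * pi * t) - cos (2 * pi * u)| <= `|2 * pi * t - 2 * pi * u|.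
  have Dc (x : R) : is_derive x 1 cos (- sin x) by exact: is_derive_cos.
  by apply: (lipschitz1 Dc) => x; rewrite normrN sin_max.
have ls : `|sin (2 * pi * t) - sin (2 * pi * u)| <= `|2 * pi * t - 2 * pi * u|.
  have Ds (x : R) : is_derive x 1 sin (cos x) by exact: is_derive_sin.
  by apply: (lipschitz1 Ds) => x; exact: cos_max.
have -> : cis t - cis u = (cos (2 * pi * t) - cos (2 * pi * u))%:C
   + (sin (2 * pi * t) - sin (2 * pi * u))%:C * 'i.
  by rewrite /cis; apply/eqP; rewrite eq_complex /=; apply/andP; split; apply/eqP; ring.
apply: le_trans (cmodD _ _) _; rewrite cmodM !cmodr.
have -> : cmod 'i = 1 :> R by rewrite /cmod /= expr0n expr1n add0r sqrtr1.
have -> : cis_lip * `|t - u| = `|2 * pi * t - 2 * pi * u| + `|2 * pi * t - 2 * pi * u|.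
  rewrite -mulrBr normrM ger0_norm ?mulr_ge0 ?pi_ge0 // /cis_lip; ring.
by rewrite mulr1 lerD.
Qed.

Definition circ r t : R[i] := r%:C * cis t.

Lemma cmod_circ r t : 0 < r -> cmod (circ r t) = r.
Proof. by move=> r0; rewrite cmodM cmod_cis mulr1 cmodr gtr0_norm. Qed.

Lemma circ_lipschitz r t u : 0 < r -> cmod (circ r t - circ r u) <= cis_lip * r * `|t - u|.
Proof.
move=> r0; rewrite -mulrBr cmodM cmodr gtr0_norm // mulrAC mulrC.
by rewrite ler_pM2r // cis_lipschitz.
Qed.

Lemma circ_lipschitz_on r a s : 0 < r -> lipschitz_on (circ r) (cis_lip * r) a s.
Proof. by move=> r0 t u _ _; exact: circ_lipschitz. Qed.

Lemma tcontinuous_circ r G : 0 < r ->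
  (forall w, cmod w = r -> exists d, cdiff G w d) ->
  tcontinuous (fun t => G (circ r t)).
Proof.
move=> r0 GD t e e0; have [d Hd] := GD _ (cmod_circ t r0).
have [s s0 Hs] := cdiff_continuous Hd e0.
have K0 : 0 < cis_lip * r by rewrite mulr_gt0 ?cis_lip_gt0.
exists (s / (cis_lip * r)); first by rewrite divr_gt0.
move=> u; rewrite ltr_pdivlMr // mulrC => H; apply: Hs.
exact: le_lt_trans (circ_lipschitz _ _ r0) H.
Qed.

(** Cauchy's theorem, a puncture [y] being allowed near which [G] is only
    bounded, as happens for the difference quotients of Cauchy's formula. The
    segments from [y] contract the circle to a curve around [y], so short that
    the bound [M] makes its integral negligible; Goursat's lemma compares the
    two curves. *)
Lemma circle_integral_eq0 G y r M (d : R) : 0 < r -> cmod y < r -> 0 < d ->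
  (forall w, cmod w <= r -> w != y -> exists D, cdiff G w D) ->
  (forall w, w != y -> cmod (w - y) < d -> cmod (G w) <= M) ->
  pint (circ r) (fun t => G (circ r t)) = 0.
Proof.
move=> r0 yr d0 GD GM.
have circy t : circ r t != y.
  by apply/eqP => /(congr1 (@cmod R)); rewrite cmod_circ // => h; rewrite h ltxx in yr.
have gC : tcontinuous (fun t => G (circ r t)).
  by apply: tcontinuous_circ => // w wr; apply: GD; rewrite ?wr //; apply/eqP => wy; rewrite -wy wr ltxx in yr.
apply: cmod_small => e e0.
pose K : R := cis_lip * r; have K0 : 0 < K by rewrite mulr_gt0 ?cis_lip_gt0.
pose M' : R := `|M| + 1; have M'0 : 0 < M' by rewrite ltr_wpDl.
pose x0 : R := Num.min (1 / 2) (Num.min (d / (4 * r)) (e / (4 * K * M'))).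
have r40 : 0 < 4 * r by exact: mulr_gt0.
have KM0 : 0 < 4 * K * M' by apply: mulr_gt0 => //; exact: mulr_gt0.
have x00 : 0 < x0.
  by rewrite /x0 !lt_min !divr_gt0.
have x01 : x0 <= 1 / 2 by rewrite ge_min lexx.
have x0d : x0 * (2 * r) < d.
  have : x0 <= d / (4 * r) by rewrite !ge_min lexx !orbT.
  rewrite ler_pdivlMr //; lra.
have x0e : x0 * K * M' <= e / 4.
  have : x0 <= e / (4 * K * M') by rewrite !ge_min lexx !orbT.
  rewrite ler_pdivlMr //; lra.
(* [P 1] is the circle, and [P 0] its homothetic image of ratio [x0] about [y]. *)
pose P (x t : R) : R[i] := y + (x0 + x * (1 - x0))%:C * (circ r t - y).
have c0 (x : R) : 0 <= x <= 0 + 1 -> 0 < x0 + x * (1 - x0) <= 1.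
  move=> /andP[a b]; apply/andP; split; nra.
have cy t : cmod (circ r t - y) <= 2 * r.
  by apply: le_trans (cmodB _ _) _; rewrite cmod_circ //; lra.
have e40 : 0 < e / 4 by rewrite divr_gt0.
pose L : R := K + 2 * r; have L0 : 0 < L by rewrite addr_gt0 // mulr_gt0.
have [||| n0 H] := @goursat R P G L 0 0 1 L0 ltr01 _ _ _ (e / 4) e40.
- move=> t _ x x' hx hx'; rewrite /P.
  have -> : y + (x0 + x * (1 - x0))%:C * (circ r t - y) -
     (y + (x0 + x' * (1 - x0))%:C * (circ r t - y)) =
     ((x - x') * (1 - x0))%:C * (circ r t - y).
    by rewrite !(rmorphD, rmorphM, rmorphB, rmorphN) /=; ring.
  rewrite cmodM cmodr normrM (@ger0_norm _ (1 - x0)); last by lra.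
  have := cy t; have := cmod_ge0 (circ r t - y); have := normr_ge0 (x - x') => h1 h2 h3.
  rewrite -mulrA mulrC ler_wpM2r //; rewrite /L; nra.
- move=> x hx t t' _ _; rewrite /P.
  have -> : y + (x0 + x * (1 - x0))%:C * (circ r t - y) -
     (y + (x0 + x * (1 - x0))%:C * (circ r t' - y)) =
     (x0 + x * (1 - x0))%:C * (circ r t - circ r t') by ring.
  have /andP[h1 h2] := c0 _ hx.
  rewrite cmodM cmodr gtr0_norm //.
  have := circ_lipschitz t t' r0; have := cmod_ge0 (circ r t - circ r t').
  have := normr_ge0 (t - t'); rewrite -/K /L => h3 h4 h5; nra.
- move=> x t hx _; have /andP[h1 h2] := c0 _ hx; apply: GD.
    have -> : P x t = (x0 + x * (1 - x0))%:C * circ r t + (1 - (x0 + x * (1 - x0)))%:C * y.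
      by rewrite /P !(rmorphD, rmorphM, rmorphB, rmorphN, rmorph1) /=; ring.
    apply: le_trans (cmodD _ _) _; rewrite [cmod (_ * circ _ _)]cmodM cmod_circ //.
    rewrite cmodM !cmodr gtr0_norm //.
    rewrite ger0_norm; last by lra.
    nra.
  rewrite /P -subr_eq0 addrC addKr mulf_eq0 negb_or subr_eq0 circy andbT.
  by rewrite -cmod_gt0 cmodr gtr0_norm.
have lim := psum_cvg (circ_lipschitz_on r0) gC.
have e20 : 0 < e / 4 by rewrite divr_gt0.
have /cvg_seqP/(_ _ e20)[n1 H1] := lim.
pose n := maxn n0 n1.
have := H n (leq_maxl _ _); have := H1 n (leq_maxr _ _).
(* The edges [t = 0] and [t = 1] coincide and cancel. *)
have bsE : boundary_sum P G n 0 0 1 = psum (circ r) (fun t => G (circ r t)) n 0 1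
     - psum (P 0) (fun t => G (P 0 t)) n 0 1.
  rewrite /boundary_sum !add0r.
  have -> : P^~ 1 = P^~ 0.
    by apply/funext => x; rewrite /P /circ cis0 cis1.
  have -> : P 1 = circ r.
    by apply/funext => x; rewrite /P mul1r [x0 + _]addrC subrK mul1r addrC subrK.
  have -> : (fun t => G (P t 1)) = (fun t => G (P t 0)).
    by apply/funext => x; rewrite /P /circ cis0 cis1.
  ring.
rewrite bsE expr1n mulr1 => h1 h2.
have h3 : cmod (psum (P 0) (fun t => G (P 0 t)) n 0 1) <= e / 4.
  apply: le_trans x0e.
  have := @psum_bound R (P 0) (fun t => G (P 0 t)) (x0 * K) M' n 0 1 ler01.
  rewrite mulr1; apply.
    move=> t t' _ _; rewrite /P mul0r addr0.
    have -> : y + x0%:C * (circ r t - y) - (y + x0%:C * (circ r t' - y)) = x0%:C * (circ r t - circ r t').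
      by ring.
    by rewrite cmodM cmodr gtr0_norm // -mulrA ler_pM2l // circ_lipschitz.
  move=> t _; have py : P 0 t - y = x0%:C * (circ r t - y).
    by rewrite /P mul0r addr0 addrC addKr.
  apply: le_trans (GM _ _ _) _.
  - rewrite -subr_eq0 py mulf_eq0 negb_or subr_eq0 circy andbT.
    by rewrite -cmod_gt0 cmodr gtr0_norm.
  - rewrite py cmodM cmodr gtr0_norm //; apply: le_lt_trans x0d.
    by rewrite ler_pM2l.
  - rewrite /M'; apply: le_trans (ler_norm _) _; lra.
have -> : pint (circ r) (fun t => G (circ r t)) =
   - (psum (circ r) (fun t => G (circ r t)) n 0 1 - pint (circ r) (fun t => G (circ r t)))
   + (psum (circ r) (fun t => G (circ r t)) n 0 1 - psum (P 0) (fun t => G (P 0 t)) n 0 1)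
   + psum (P 0) (fun t => G (P 0 t)) n 0 1 by ring.
apply: le_trans (cmodD _ _) _; apply: le_trans (lerD (cmodD _ _) (lexx _)) _.
rewrite cmodN; lra.
Qed.

End Circle.

(** * Calculus of complex derivatives *)

Section Derivability.
Variable R : realType.
Implicit Types (f g : R[i] -> R[i]) (z c : R[i]).

Lemma cderivable_cst c z : derivable (fun=> c : R[i]) z 1.
Proof. exact: derivable_cst. Qed.

Lemma cderivable_id z : derivable (fun w : R[i] => w) z 1.
Proof. exact: derivable_id. Qed.

Lemma cderivableD f g z : derivable f z 1 -> derivable g z 1 ->
  derivable (fun w => f w + g w) z 1.
Proof. exact: derivableD. Qed.

Lemma cderivableB f g z : derivable f z 1 -> derivable g z 1 ->
  derivable (fun w => f w - g w) z 1.
Proof. exact: derivableB. Qed.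

Lemma cderivableM f g z : derivable f z 1 -> derivable g z 1 ->
  derivable (fun w => f w * g w) z 1.
Proof. exact: derivableM. Qed.

Lemma cderivableV f z : f z != 0 -> derivable f z 1 -> derivable (fun w => (f w)^-1) z 1.
Proof. exact: derivableV. Qed.

Lemma cderivableX f n z : derivable f z 1 -> derivable (fun w => f w ^+ n) z 1.
Proof.
move=> df; elim: n => [|n IH]; first exact: cderivable_cst.
have -> : (fun w => f w ^+ n.+1) = (fun w => f w * f w ^+ n).
  by apply/funext => w; rewrite exprS.
exact: cderivableM.
Qed.

Lemma cderivable_subc c z : derivable (fun w => w - c) z 1.
Proof. by apply: cderivableB; [exact: cderivable_id|exact: cderivable_cst]. Qed.

Lemma cderivable_addc c z : derivable (fun w => w + c) z 1.
Proof. by apply: cderivableD; [exact: cderivable_id|exact: cderivable_cst]. Qed.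

Lemma cderivable_subcX c n z : derivable (fun w => (w - c) ^+ n) z 1.
Proof. by apply: (@cderivableX (fun w => w - c)); exact: cderivable_subc. Qed.

Lemma cderivable_addcX c n z : derivable (fun w => (w + c) ^+ n) z 1.
Proof. by apply: (@cderivableX (fun w => w + c)); exact: cderivable_addc. Qed.

Lemma cderivable_idX n z : derivable (fun w : R[i] => w ^+ n) z 1.
Proof. by apply: (@cderivableX id); exact: cderivable_id. Qed.

Lemma cdiff_comp f g z d d' : cdiff f z d -> cdiff g (f z) d' ->
  cdiff (fun w => g (f w)) z (d' * d).
Proof.
move=> fd gd e e0.
pose D : R := cmod d + 1; have D0 : 0 < D by rewrite ltr_wpDl ?cmod_ge0.
pose D' : R := cmod d' + 1; have D'0 : 0 < D' by rewrite ltr_wpDl ?cmod_ge0.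
have e1 : 0 < e / (2 * D) by apply: divr_gt0 => //; exact: mulr_gt0.
have e2 : 0 < Num.min 1 (e / (2 * D')).
  by rewrite lt_min ltr01; apply: divr_gt0 => //; exact: mulr_gt0.
have [r1 r10 H1] := gd _ e1; have [r2 r20 H2] := fd _ e2.
have [r3 r30 H3] := cdiff_continuous fd r10.
exists (Num.min r2 r3); first by rewrite lt_min r20.
move=> w; rewrite lt_min => /andP[/H2 h2 /H3/H1 h1].
have -> : g (f w) - g (f z) - d' * d * (w - z) =
  g (f w) - g (f z) - d' * (f w - f z) + d' * (f w - f z - d * (w - z)) by ring.
apply: le_trans (cmodD _ _) _; rewrite [cmod (d' * _)]cmodM.
set W := cmod (w - z) in h1 h2 *; have W0 : 0 <= W by exact: cmod_ge0.
have h3 : cmod (f w - f z) <= D * W.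
  rewrite -(subrK (d * (w - z)) (f w - f z)); apply: le_trans (cmodD _ _) _.
  rewrite cmodM -/W /D addrC mulrDl lerD2l; apply: le_trans h2 _.
  by rewrite ler_wpM2r // ge_min lexx.
rewrite (splitr e) mulrDl; apply: lerD.
  apply: le_trans h1 _; have := ler_wpM2l (ltW e1) h3.
  by have -> : e / (2 * D) * (D * W) = e / 2 * W by field; rewrite gt_eqF.
apply: (@le_trans _ _ (D' * (e / (2 * D') * W))).
  apply: ler_pM; rewrite ?cmod_ge0 //; first by rewrite /D' lerDl.
  by apply: le_trans h2 _; rewrite ler_wpM2r // ge_min lexx orbT.
by have -> : D' * (e / (2 * D') * W) = e / 2 * W by field; rewrite gt_eqF.
Qed.

Lemma cderivable_comp f g z : derivable f z 1 -> derivable g (f z) 1 ->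
  derivable (fun w => g (f w)) z 1.
Proof. by move=> /derive1_cdiff fd /derive1_cdiff /(cdiff_comp fd)/cdiff_derivable. Qed.

Lemma cdiff_near_eq f g z d (e : R) : 0 < e ->
  (forall w, cmod (w - z) < e -> f w = g w) -> cdiff f z d -> cdiff g z d.
Proof.
move=> e0 fg fd s s0; have [r r0 H] := fd s s0.
exists (Num.min r e); first by rewrite lt_min r0.
move=> w; rewrite lt_min => /andP[wr we]; rewrite -!fg ?subrr ?cmod0 //.
exact: H.
Qed.

Lemma cderivable_near_eq f g z (e : R) : 0 < e ->
  (forall w, cmod (w - z) < e -> f w = g w) -> derivable f z 1 -> derivable g z 1.
Proof. by move=> e0 fg /derive1_cdiff/(cdiff_near_eq e0 fg)/cdiff_derivable. Qed.

Lemma cderivable_cvg f z : derivable f z 1 -> f w @[w --> z^'] --> f z.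
Proof.
move=> /derive1_cdiff fd; apply/cvg_cmodP => e e0; apply/dnbhs_cmodP.
by have [r r0 H] := cdiff_continuous fd e0; exists r => // w _ /H.
Qed.

End Derivability.

(** * Contour integrals over circles *)

Section CircleIntegral.
Variable R : realType.
Implicit Types (r : R) (F G H : R[i] -> R[i]) (y w : R[i]).

(** The contour integral of [F(w) dw] over the circle of radius [r] about [0]. *)
Definition cint r F : R[i] := pint (circ r) (fun t => F (circ r t)).

Definition circ_derivable r F := forall w, cmod w = r -> derivable F w 1.

Lemma cint_cvg r F : 0 < r -> circ_derivable r F ->
  psum (circ r) (fun t => F (circ r t)) p 0 1 @[p --> \oo] --> cint r F.
Proof.
move=> r0 FD; apply: (psum_cvg (circ_lipschitz_on r0)).
by apply: tcontinuous_circ => // w /FD/derive1_cdiff; exists (F^`() w)%classic.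
Qed.

Lemma cintE r F (l : R[i]) : (psum (circ r) (fun t => F (circ r t)) p 0 1 @[p --> \oo] --> l) ->
  cint r F = l.
Proof. exact: norm_cvg_lim. Qed.

Lemma cintZ r u F : 0 < r -> circ_derivable r F ->
  cint r (fun w => u * F w) = u * cint r F.
Proof.
move=> r0 FD; apply: cintE.
under eq_fun do rewrite psumZ.
exact: (cvgMl_tmp (cint_cvg r0 FD)).
Qed.

Lemma cintD r F G : 0 < r -> circ_derivable r F -> circ_derivable r G ->
  cint r (fun w => F w + G w) = cint r F + cint r G.
Proof.
move=> r0 FD GD; apply: cintE.
under eq_fun do rewrite psumD.
exact: (cvgD (cint_cvg r0 FD) (cint_cvg r0 GD)).
Qed.

Lemma cint_bound r F M : 0 < r -> circ_derivable r F ->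
  (forall t, 0 <= t <= 1 -> cmod (F (circ r t)) <= M) -> cmod (cint r F) <= cis_lip R * r * M.
Proof.
move=> r0 FD FM; apply/ler_addgt0Pr => e e0.
have /cvg_seqP/(_ _ e0)[n H] := cint_cvg r0 FD.
have := H n (leqnn n).
have := @psum_bound R (circ r) (fun t => F (circ r t)) _ M n 0 1 ler01 (circ_lipschitz_on r0).
rewrite mulr1 add0r => /(_ FM).
have := cmod_triangle (cint r F) (psum (circ r) (fun t => F (circ r t)) n 0 1) 0.
by rewrite !subr0 cmod_sym; lra.
Qed.

Lemma circ_bounded r F : 0 < r -> circ_derivable r F ->
  exists M : R, forall t, 0 <= t <= 1 -> cmod (F (circ r t)) <= M.
Proof.
move=> r0 FD.
have gC : tcontinuous (fun t => F (circ r t)).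
  by apply: tcontinuous_circ => // w /FD/derive1_cdiff; exists (F^`() w)%classic.
pose P x s := exists M, forall t, x <= t <= x + s -> cmod (F (circ r t)) <= M.
have [||M HM] := @interval_bisection R P 0 1 _ ltr01.
- move=> x s s0 [M1 H1] [M2 H2]; exists (Num.max M1 M2) => t ht.
  rewrite le_max; have [h|h] := leP t (x + s / 2).
    by rewrite H1 //; lra.
  by rewrite H2 ?orbT //; lra.
- move=> x0 _; have [d d0 H] := gC x0 1 ltr01; exists d => // x s sd xx _ _.
  exists (1 + cmod (F (circ r x0))) => t ht.
  have : `|t - x0| < d by rewrite ltr_norml; lra.
  move=> /H; have := cmod_triangle (F (circ r t)) (F (circ r x0)) 0; rewrite !subr0; lra.
- by exists M => t; rewrite -(add0r 1); exact: HM.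
Qed.

End CircleIntegral.

(** * Contour integrals of powers *)

Section CircleMonomials.
Variable R : realType.
Implicit Types (r a b s : R) (m : int) (p v : nat).

Lemma cis_half : cis (1 / 2) = -1 :> R[i].
Proof.
rewrite /cis (_ : 2 * pi * (1 / 2) = pi :> R); last by field.
by rewrite cospi sinpi; apply/eqP; rewrite eq_complex /= oppr0 !eqxx.
Qed.

Definition monomial_sum r m p a s : R[i] :=
  psum (circ r) (fun t => circ r t ^ (m - 1)) p a s.

(** A rotation by [cis a] multiplies [w ^ (m - 1) dw] by [cis a ^ m]. *)
Lemma monomial_sum_rot r m p a b s : 0 < r ->
  monomial_sum r m p (a + b) s = cis a ^ m * monomial_sum r m p b s.
Proof.
move=> r0; have shift t : circ r (a + t) = cis a * circ r t.
  by rewrite /circ cisD mulrCA.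
elim: p b s => [|p IH] b s; rewrite /monomial_sum /=; last first.
  by rewrite mulrDr -/(monomial_sum r m p b (s / 2))
    -/(monomial_sum r m p (b + s / 2) (s / 2)) -!IH addrA.
rewrite -addrA !shift (expfzMl _ (circ r b)) (expfzMl _ (circ r (b + s))).
have -> : cis a ^ m = cis a * cis a ^ (m - 1).
  by rewrite -{2}[cis a]expr1z -expfzDr ?cis_neq0 // addrC subrK.
by rewrite -mulrBr -mulrDr -[_ * (_ + _) / 2]mulrA mulrACA.
Qed.

Lemma monomial_sum_step r m p s : 0 < r ->
  monomial_sum r m p.+1 0 s = (1 + cis (s / 2) ^ m) * monomial_sum r m p 0 (s / 2).
Proof.
move=> r0; rewrite mulrDl mul1r -monomial_sum_rot // addr0.
by rewrite /monomial_sum /= add0r.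
Qed.

Lemma monomial_sum_unroll r m p v s : 0 < r ->
  exists c, monomial_sum r m (p + v) 0 s = c * monomial_sum r m p 0 (s / 2 ^+ v).
Proof.
move=> r0; elim: v s => [|v IH] s; first by exists 1; rewrite addn0 divr1 mul1r.
have [c Hc] := IH (s / 2); exists ((1 + cis (s / 2) ^ m) * c).
by rewrite addnS monomial_sum_step // Hc exprS invfM !mulrA.
Qed.

(** Let [v] be the 2-adic valuation of [m]. The rotation that carries the first
    half of an arc of parameter length [1 / 2 ^ v] to the second half multiplies
    [w ^ (m - 1) dw] by [-1], so that the two halves cancel. *)
Lemma monomial_sum_eq0 r m : 0 < r -> m != 0 ->
  exists n0, forall p, (n0 <= p)%N -> monomial_sum r m p 0 1 = 0.
Proof.
move=> r0 m0.
have m0' : (0 < `|m|)%N by rewrite absz_gt0.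
have [k k2 mE] := pfactor_coprime (isT : prime 2) m0'.
set v := logn 2 _ in mE; exists v.+1 => p vp.
have odd_k : odd k by rewrite coprime2n in k2.
have [c ->] : exists c, monomial_sum r m p 0 1 = c * monomial_sum r m (p - v) 0 (1 / 2 ^+ v).
  by have := monomial_sum_unroll m (p - v) v 1 r0; rewrite subnK // ltnW.
have [q ->] : exists q, (p - v)%N = q.+1.
  by exists (p - v).-1; rewrite prednK // subn_gt0.
rewrite monomial_sum_step // (_ : 1 + _ = 0) ?mul0r ?mulr0 //.
suff E : cis (1 / 2 ^+ v / 2) ^ m = -1 :> R[i] by rewrite E subrr.
have Ea : cis (1 / 2 ^+ v / 2) ^+ `|m|%N = -1 :> R[i].
  rewrite mE mulnC exprM cisX natrX.
  have -> : 1 / 2 ^+ v / 2 * 2 ^+ v = 1 / 2 :> R.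
    by rewrite mulrAC divfK // expf_neq0 // pnatr_eq0.
  by rewrite cis_half -signr_odd odd_k expr1.
case: (m) Ea => n /=; first by rewrite -exprnP.
by move=> E; rewrite -[LHS]/((_ ^+ n.+1)^-1) E invrN invr1.
Qed.

Lemma circ_derivable_exprz r m : 0 < r -> circ_derivable r (fun w => w ^ m).
Proof.
move=> r0 w wr; have w0 : w != 0 by rewrite -cmod_gt0 wr.
case: m => n; first exact: cderivable_idX.
apply: cderivableV; first by rewrite expf_neq0.
exact: cderivable_idX.
Qed.

Lemma cint_monomial_eq0 r m : 0 < r -> m != 0 -> cint r (fun w => w ^ (m - 1)) = 0.
Proof.
move=> r0 m0; apply: cintE; apply/cvg_seqP => e e0.
have [n0 H] := monomial_sum_eq0 r0 m0; exists n0 => n n0n.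
by rewrite [X in cmod (X - _)](H n n0n) subrr cmod0.
Qed.

(** Twice the area of the regular polygon with [2 ^ p] sides inscribed in the
    unit circle. *)
Definition inscribed_area p : R := 2 ^+ p * sin (2 * pi * (1 / 2 ^+ p)).

Lemma monomial_sum0 r p : 0 < r ->
  monomial_sum r 0 p 0 1 = (inscribed_area p)%:C * 'i.
Proof.
move=> r0.
have gen s : monomial_sum r 0 p 0 s = 2 ^+ p * monomial_sum r 0 0 0 (s / 2 ^+ p).
  elim: p s => [|p IH] s; first by rewrite !expr0 divr1 mul1r.
  rewrite monomial_sum_step // expr0z IH mulrA.
  have -> : s / 2 ^+ p.+1 = s / 2 / 2 ^+ p by rewrite exprS invfM mulrA.
  by congr (_ * _); rewrite exprS.
rewrite gen.
rewrite /monomial_sum /= /inscribed_area add0r sub0r.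
have r0' : r%:C != 0 by rewrite -cmod_gt0 cmodr normr_gt0 gt_eqF.
rewrite {2 4}/circ !expfzMl /circ cis0 !exprN1 invr1.
set z := cis _.
have zV : z^-1 = (z)^*%C.
  apply: (mulfI (cis_neq0 (1 / 2 ^+ p))); rewrite mulfV ?cis_neq0 // /z /cis.
  apply/eqP; rewrite eq_complex /=; apply/andP; split; apply/eqP.
    by rewrite mulrN opprK -!expr2 cos2Dsin2.
  by rewrite mulrN mulrC addNr.
have -> : (2 ^+ p : R[i]) = (2 ^+ p : R)%:C by rewrite rmorphXn rmorph_nat.
have -> : (r%:C * z - r%:C * 1) * ((r%:C ^-1 * 1 + r%:C^-1 * z^-1) / 2) = (z - z^-1) / 2.
  by field; rewrite cis_neq0.
have -> : (z - z^-1) / 2 = (sin (2 * pi * (1 / 2 ^+ p)))%:C * 'i.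
  apply: (canLR (mulfK _)); first by rewrite pnatr_eq0.
  rewrite zV /z /cis; apply/eqP; rewrite eq_complex /=; apply/andP; split; apply/eqP; ring.
by rewrite mulrA -rmorphM.
Qed.

(** Monotone in [p] by the duplication formula, with value [4] at [p = 2]. *)
Lemma inscribed_area_ge4 p : 4 <= inscribed_area (p + 2).
Proof.
elim: p => [|p IH].
  rewrite /inscribed_area (_ : 2 * pi * _ = pi / 2) ?sin_pihalf; last by field.
  by rewrite mulr1; lra.
apply: le_trans IH _; rewrite addSn /inscribed_area.
set x : R := 2 * pi * (1 / 2 ^+ (p + 2).+1).
have -> : 2 * pi * (1 / 2 ^+ (p + 2)) = x *+ 2 :> R.
  by rewrite /x exprS; field; rewrite expf_neq0 // pnatr_eq0.
have K1 : 1 <= 2 ^+ (p + 2) :> R by rewrite exprn_ege1 // ler1n.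
have x0 : 0 <= x by rewrite !mulr_ge0 ?pi_ge0 // invr_ge0 exprn_ge0.
have xpi : x <= pi.
  rewrite /x exprS mul1r invfM [2 * pi]mulrC mulrA mulfK // ler_pdivrMr ?exprn_gt0 //.
  by rewrite ler_peMr ?pi_ge0.
have S0 : 0 <= sin x by rewrite sin_ge0_pi // x0.
have C1 := cos_le1 x.
have -> : sin (x *+ 2) = 2 * (cos x * sin x) by rewrite sin_mulr2n mulr_natl.
have -> : 2 ^+ (p + 2).+1 * sin x = 2 ^+ (p + 2) * (2 * sin x).
  by rewrite exprS (mulrC 2) -mulrA.
rewrite ler_pM2l; last by lra.
by rewrite ler_pM2l // ler_piMl.
Qed.

(** The normalizing factor of Cauchy's formula. *)
Lemma cint_inv_neq0 r : 0 < r -> cint r (fun w => w ^ (-1)) != 0.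
Proof.
move=> r0; apply/eqP => E.
have := cint_cvg r0 (@circ_derivable_exprz r (-1) r0).
rewrite E => /cvg_seqP/(_ 1 ltr01)[n H].
have := H (n + 2)%N (leq_addr _ _); rewrite subr0.
have := monomial_sum0 (n + 2) r0; rewrite /monomial_sum sub0r => ->.
rewrite cmodM cmodr.
have -> : cmod 'i = 1 :> R by rewrite /cmod /= expr0n expr1n add0r sqrtr1.
have := inscribed_area_ge4 n; have := ler_norm (inscribed_area (n + 2)); lra.
Qed.

End CircleMonomials.

(** * Power series *)

Section GeometricSeries.
Variable R : realType.
Implicit Types (u b : nat -> R[i]) (w z : R[i]) (q r M : R).

Lemma pow_small q M e : 0 <= q < 1 -> 0 < e ->
  exists n0, forall n, (n0 <= n)%N -> M * q ^+ n < e.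
Proof.
move=> /andP[q0 q1] e0.
pose M' := `|M| + 1; have M'0 : 0 < M' by rewrite ltr_wpDl.
have : (fun n => q ^+ n) @ \oo --> (0 : R) by apply: cvg_expr; rewrite ger0_norm.
move=> /cvgrPdist_lt/(_ (e / M')); rewrite divr_gt0 // => /(_ isT)[n0 _ H].
exists n0 => n /H; rewrite sub0r normrN ger0_norm ?exprn_ge0 // ltr_pdivlMr // mulrC.
apply: le_lt_trans; rewrite ler_wpM2r ?exprn_ge0 //.
by rewrite /M'; apply: le_trans (ler_norm _) _; rewrite lerDl.
Qed.

Lemma series_sum u n : series u n = \sum_(0 <= k < n) u k.
Proof. by rewrite seriesEnat. Qed.

Definition geom_bounded u := exists M q, [/\ 0 <= q, q < 1, 0 <= M & forall k, cmod (u k) <= M * q ^+ k].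

Lemma series_dist u M q m n : 0 <= q < 1 -> 0 <= M -> (forall k, cmod (u k) <= M * q ^+ k) ->
  (m <= n)%N -> cmod (series u n - series u m) <= M * q ^+ m / (1 - q).
Proof.
move=> /andP[q0 q1] M0 H mn; have q1' : 0 < 1 - q by rewrite subr_gt0.
suff : cmod (series u n - series u m) <= (M * q ^+ m - M * q ^+ n) / (1 - q).
  move=> h; apply: le_trans h _; rewrite ler_pM2r ?invr_gt0 //.
  by rewrite gerBl mulr_ge0 // exprn_ge0.
rewrite -(subnK mn) addnC; elim: (n - m)%N => [|j IH].
  by rewrite addn0 !subrr cmod0 mul0r.
rewrite addnS seriesSr addrAC; apply: le_trans (cmodD _ _) _.
have := H (m + j)%N; rewrite exprS; set Q := q ^+ (m + j) => h.
have -> : (M * q ^+ m - M * (q * Q)) / (1 - q) = (M * q ^+ m - M * Q) / (1 - q) + M * Q.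
  by field; rewrite gt_eqF.
exact: lerD.
Qed.

Lemma geom_series_cvg u : geom_bounded u -> cvg (series u @ \oo).
Proof.
move=> [M [q [q0 q1 M0 H]]]; apply: cvg_of_cauchy => e e0.
have q01 : 0 <= q < 1 by rewrite q0.
have q1' : 0 < 1 - q by rewrite subr_gt0.
have [n0 Hn] := pow_small (M / (1 - q)) q01 e0.
exists n0 => n m n0n n0m.
wlog mn : n m n0n n0m / (m <= n)%N.
  move=> W; case/orP: (leq_total m n) => h; first exact: W.
  by rewrite cmod_sym; apply: W.
apply: le_trans (series_dist q01 M0 H mn) _; rewrite mulrAC.
exact/ltW/Hn.
Qed.

Lemma geom_series_tail u M q (s : R[i]) n : 0 <= q < 1 -> 0 <= M -> (forall k, cmod (u k) <= M * q ^+ k) ->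
  series u @ \oo --> s -> cmod (s - series u n) <= M * q ^+ n / (1 - q).
Proof.
move=> q01 M0 H /cvg_seqP us; apply/ler_addgt0Pr => e e0.
have [n0 Hn] := us _ e0.
have := Hn _ (leq_maxr n n0); rewrite cmod_sym => h1.
have := series_dist q01 M0 H (leq_maxl n n0) => h2.
by have := cmod_triangle s (series u (maxn n n0)) (series u n); lra.
Qed.

Lemma series_term_bounded u (s : R[i]) : series u @ \oo --> s -> exists2 M : R, 0 < M & forall k, cmod (u k) <= M.
Proof.
move=> /cvg_seqP us; have [n0 Hn] := us 1 ltr01.
pose M := 2 + \sum_(0 <= k < n0) cmod (u k).
have S0 (r : seq nat) : 0 <= \sum_(k <- r) cmod (u k) by apply: sumr_ge0 => k _; exact: cmod_ge0.
exists M; first by have := S0 (index_iota 0 n0); rewrite /M; lra.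
move=> k; have [kn|nk] := ltnP k n0.
  rewrite /M (bigD1_seq k) /= ?mem_index_iota ?iota_uniq //.
  have : 0 <= \sum_(0 <= i < n0 | i != k) cmod (u i) by apply: sumr_ge0 => i _; exact: cmod_ge0.
  lra.
have -> : u k = series u k.+1 - series u k by rewrite seriesSr addrC addKr.
have h1 := Hn _ (leqW nk); have := Hn _ nk; rewrite cmod_sym => h2.
have := cmod_triangle (series u k.+1) s (series u k); have := S0 (index_iota 0 n0).
by rewrite /M; lra.
Qed.

Definition power_series b (F : R[i] -> R[i]) r :=
  forall w, cmod w < r -> series (fun k => b k * w ^+ k) @ \oo --> F w.

(** Inside the disc of convergence the terms decay geometrically: compare with
    the bounded terms on a slightly larger circle. *)
Lemma power_series_geom b F r (s : R) : power_series b F r -> 0 <= s < r ->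
  exists M q, [/\ 0 <= q, q < 1, 0 <= M & forall k, cmod (b k) * s ^+ k <= M * q ^+ k].
Proof.
move=> bF /andP[s0 sr].
pose t := (s + r) / 2; have st : s < t by rewrite /t; lra.
have t0 : 0 < t by apply: le_lt_trans st.
have [|M M0 HM] := series_term_bounded (bF t%:C _).
  by rewrite cmodr gtr0_norm // /t; lra.
exists M, (s / t); split; [exact: divr_ge0 s0 (ltW t0)|by rewrite ltr_pdivrMr ?mul1r|exact: ltW|].
move=> k; have := HM k; rewrite cmodM cmodX cmodr gtr0_norm // => h.
have -> : M * (s / t) ^+ k = (M * t ^- k) * s ^+ k by rewrite expr_div_n mulrA mulrAC.
by rewrite ler_wpM2r ?exprn_ge0 // ler_pdivlMr ?exprn_gt0.
Qed.

(** Both second-order remainders satisfy the same recursion in [k], in which the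
    quantities on the right are nonnegative and dominate. The point is that the
    bound is quadratic in [h] with a constant that is at most geometric in [k],
    without factors [k ^ 2]. *)
Lemma binomial_remainder (w h : R[i]) (a d : R) k : 0 < d -> cmod w <= a -> cmod h <= d ->
  cmod ((w + h) ^+ k - w ^+ k - k%:R * w ^+ k.-1 * h) * d ^+ 2
  <= cmod h ^+ 2 * ((a + d) ^+ k - a ^+ k - k%:R * a ^+ k.-1 * d).
Proof.
move=> d0 wa hd; have a0 : 0 <= a by apply: le_trans wa; exact: cmod_ge0.
elim: k => [|k IH]; first by rewrite !expr0 !mul0r !subrr cmod0 mul0r mulr0.
have pw (K : comNzRingType) (x : K) : k%:R * x ^+ k = k%:R * x ^+ k.-1 * x.
  by case: (k) => [|j]; rewrite ?mul0r // exprSr mulrA.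
rewrite -pred_Sn.
have -> : (w + h) ^+ k.+1 - w ^+ k.+1 - k.+1%:R * w ^+ k * h =
   (w + h) * ((w + h) ^+ k - w ^+ k - k%:R * w ^+ k.-1 * h) + h ^+ 2 * (k%:R * w ^+ k.-1).
  rewrite !exprS -[k.+1]addn1 natrD !mulrDl pw; ring.
have -> : (a + d) ^+ k.+1 - a ^+ k.+1 - k.+1%:R * a ^+ k * d =
   (a + d) * ((a + d) ^+ k - a ^+ k - k%:R * a ^+ k.-1 * d) + d ^+ 2 * (k%:R * a ^+ k.-1).
  rewrite !exprS -[k.+1]addn1 natrD !mulrDl pw; ring.
set D := (w + h) ^+ k - _ - _ in IH *; set E := (a + d) ^+ k - _ - _ in IH *.
have h1 : cmod (w + h) <= a + d by apply: le_trans (cmodD _ _) _; exact: lerD.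
have h2 : cmod (k%:R * w ^+ k.-1) <= k%:R * a ^+ k.-1.
  rewrite cmodM cmodn cmodX ler_wpM2l ?ler0n //.
  by apply: lerXn2r => //; rewrite nnegrE ?cmod_ge0.
have h3 := cmodD ((w + h) * D) (h ^+ 2 * (k%:R * w ^+ k.-1)).
rewrite (cmodM (w + h)) (cmodM (h ^+ 2)) (cmodX h) in h3.
have d20 : 0 <= d ^+ 2 by rewrite sqr_ge0.
apply: le_trans (ler_wpM2r d20 h3) _.
rewrite mulrDl [leRHS]mulrDr; apply: lerD.
  rewrite -mulrA [leRHS]mulrCA; apply: ler_pM => //; first exact: cmod_ge0.
  by rewrite mulr_ge0 ?cmod_ge0.
rewrite -mulrA ler_wpM2l ?sqr_ge0 ?exprn_ge0 ?cmod_ge0 //.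
by rewrite mulrC ler_wpM2l.
Qed.

(** By [binomial_remainder], the second-order remainders of the terms add up to
    at most a constant times [|h| ^ 2]. *)
Lemma power_series_derive b F r : power_series b F r ->
  exists G, power_series (fun k => k.+1%:R * b k.+1) G r /\
    forall w, cmod w < r -> cdiff F w (G w).
Proof.
move=> bF; pose u w k := k%:R * b k * w ^+ k.-1.
have data w : cmod w < r -> exists d M q : R, [/\ 0 < d, 0 <= q, q < 1, 0 <= M &
    forall k, cmod (b k) * (cmod w + d) ^+ k <= M * q ^+ k].
  move=> wr; pose d := (r - cmod w) / 2; have d0 : 0 < d by rewrite divr_gt0 // subr_gt0.
  have w0 := cmod_ge0 w.
  have [|M [q [q0 q1 M0 H]]] := @power_series_geom b F r (cmod w + d) bF.
    by rewrite /d; lra.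
  by exists d, M, q.
have E_ge0 (a d : R) k : 0 <= a -> 0 < d -> k%:R * a ^+ k.-1 * d <= (a + d) ^+ k.
  move=> a0 d0; have := @binomial_remainder 0 d%:C a d k d0.
  rewrite cmod0 cmodr gtr0_norm // => /(_ a0 (lexx _)) H.
  have : 0 <= (a + d) ^+ k - a ^+ k - k%:R * a ^+ k.-1 * d.
    rewrite -(@pmulr_rge0 _ (d ^+ 2)) ?exprn_gt0 //; apply: le_trans H.
    by rewrite mulr_ge0 ?cmod_ge0 // exprn_ge0 // ltW.
  have := exprn_ge0 k a0; lra.
have u_geom w : cmod w < r -> geom_bounded (u w).
  move=> /data[d [M [q [d0 q0 q1 M0 H]]]].
  exists (M / d), q; split => //; first exact: divr_ge0 M0 (ltW d0).
  move=> k; rewrite mulrAC ler_pdivlMr //; apply: le_trans (H k).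
  rewrite /u !cmodM cmodn cmodX (mulrC _ (cmod (b k))) -!mulrA ler_wpM2l ?cmod_ge0 //.
  by rewrite mulrA E_ge0 // cmod_ge0.
have [G HG] : exists G : R[i] -> R[i], forall w, cmod w < r -> series (u w) @ \oo --> G w.
  have [G HG] : exists G : R[i] -> R[i], forall w, cmod w < r -> series (u w) @ \oo --> G w.
    exists (fun w => lim (series (u w) @ \oo)) => w /u_geom/geom_series_cvg. by [].
  by exists G.
exists G; split=> w wr.
  have /cvg_seqP H := HG w wr; apply/cvg_seqP => e /H[n0 Hn]; exists n0 => n n0n.
  have := Hn n.+1 (leqW n0n); congr (cmod (_ - _) < _).
  by rewrite series_sum big_nat_recl //= /u !mul0r add0r series_sum.
have [d [M [q [d0 q0 q1 M0 H]]]] := data w wr.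
have q01 : 0 <= q < 1 by rewrite q0.
pose C := M / (1 - q) / d ^+ 2.
have C0 : 0 <= C by rewrite !divr_ge0 ?sqr_ge0 // subr_ge0 ltW.
move=> e e0.
exists (Num.min (Num.min d (r - cmod w)) (e / (C + 1))).
  by rewrite !lt_min d0 subr_gt0 wr divr_gt0 // ltr_wpDl.
move=> z; rewrite !lt_min => /andP[/andP[zd zr] ze].
have zr' : cmod z < r.
  have := cmodD (z - w) w; rewrite subrK; lra.
set h := z - w in zd zr ze *.
have zE : z = w + h by rewrite /h addrC subrK.
pose v k := b k * (z ^+ k - w ^+ k - k%:R * w ^+ k.-1 * h).
have v_cvg : series v @ \oo --> F z - F w - G w * h.
  have -> : series v = fun n => series (fun k => b k * z ^+ k) n
      - series (fun k => b k * w ^+ k) n - series (u w) n * h.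
    apply/funext => n; rewrite !series_sum mulr_suml -!sumrB; apply: eq_bigr => k _.
    by rewrite /v /u; ring.
  exact: cvgB (cvgB (bF z zr') (bF w wr)) (cvgMr_tmp (HG w wr)).
have v_bound k : cmod (v k) <= (cmod h ^+ 2 / d ^+ 2 * M) * q ^+ k.
  have := binomial_remainder k d0 (lexx (cmod w)) (ltW zd); rewrite -zE => hk.
  rewrite -mulrA; apply: le_trans (ler_wpM2l _ (H k)); last by rewrite divr_ge0 ?sqr_ge0 ?exprn_ge0 ?cmod_ge0.
  rewrite /v cmodM [leRHS]mulrCA ler_wpM2l ?cmod_ge0 // [leRHS]mulrAC ler_pdivlMr ?exprn_gt0 //.
  apply: le_trans hk _; rewrite ler_wpM2l ?exprn_ge0 ?cmod_ge0 //.
  have : 0 <= cmod w ^+ k by rewrite exprn_ge0 ?cmod_ge0.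
  have : 0 <= k%:R * cmod w ^+ k.-1 * d by rewrite !mulr_ge0 ?exprn_ge0 ?cmod_ge0 ?ler0n // ltW.
  lra.
have M1 : 0 <= cmod h ^+ 2 / d ^+ 2 * M by rewrite mulr_ge0 // divr_ge0 ?exprn_ge0 ?cmod_ge0 ?ltW.
have := geom_series_tail 0 q01 M1 v_bound v_cvg.
rewrite series_sum big_nil subr0 expr0 mulr1 => hh.
apply: le_trans hh _.
have -> : cmod h ^+ 2 / d ^+ 2 * M / (1 - q) = C * cmod h * cmod h.
  by rewrite /C; field; rewrite gt_eqF // gt_eqF // subr_gt0.
rewrite ler_wpM2r ?cmod_ge0 //; move: ze; rewrite ltr_pdivlMr ?ltr_wpDl //.
have := cmod_ge0 h; nra.
Qed.

Lemma power_series0 b F r : 0 < r -> power_series b F r -> F 0 = b 0%N.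
Proof.
move=> r0 bF; have /cvg_seqP H := bF 0 (eq_ind_r (fun x => x < r) r0 (cmod0 R)).
apply/eqP; rewrite -subr_eq0; apply/eqP/cmod_small => e /H[n0 Hn].
have := Hn n0.+1 (leqnSn _); rewrite series_sum big_nat_recl //= big1.
  by rewrite expr0 mulr1 addr0 cmod_sym => /ltW.
by move=> k _; rewrite exprS mul0r mulr0.
Qed.

Lemma power_series_derive1n b F r n : 0 < r -> power_series b F r ->
  (F^`(n))%classic 0 = n`!%:R * b n.
Proof.
move=> r0; elim: n b F => [|n IH] b F bF.
  by rewrite derive1n0 (power_series0 r0 bF) mul1r.
have [G [bG FG]] := power_series_derive bF.
have bG' : power_series (fun k => k.+1%:R * b k.+1) (F^`())%classic r.
  by move=> w wr; rewrite (cdiff_derive1 (FG w wr)); exact: bG.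
by rewrite derive1Sn (IH _ _ bG') mulrA -natrM factS mulnC.
Qed.

Lemma power_series_derivable b F r w : power_series b F r -> cmod w < r -> derivable F w 1.
Proof.
by move=> /power_series_derive[G [_ FG]] /FG/cdiff_derivable.
Qed.

Lemma taylor_coefE b F r n : 0 < r -> power_series b F r -> taylor_coef F n = b n.
Proof.
move=> r0 bF; rewrite /taylor_coef (power_series_derive1n n r0 bF).
by rewrite mulrAC divff ?mul1r // pnatr_eq0 -lt0n fact_gt0.
Qed.

End GeometricSeries.

(** * Taylor's theorem *)

Section TaylorTheorem.
Variable R : realType.
Implicit Types (r : R) (F H : R[i] -> R[i]) (y w : R[i]).

Lemma eq_cint r F H : 0 < r -> (forall w, cmod w = r -> F w = H w) -> cint r F = cint r H.
Proof.
move=> r0 FH; congr pint; apply/funext => t.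
by rewrite FH // cmod_circ.
Qed.

Lemma cvg_seq_unique (u : nat -> R[i]) (a b : R[i]) :
  u @ \oo --> a -> u @ \oo --> b -> a = b.
Proof. by move=> /norm_cvg_lim <- /norm_cvg_lim <-. Qed.

Lemma circ_sub_neq0 r y w : cmod y < r -> cmod w = r -> w - y != 0.
Proof. by move=> yr wr; rewrite subr_eq0; apply/eqP => wy; rewrite -wy wr ltxx in yr. Qed.

Lemma circ_derivable_kernel r H y k : 0 < r -> cmod y < r -> circ_derivable r H ->
  circ_derivable r (fun w => H w * w ^- k / (w - y)).
Proof.
move=> r0 yr HD w wr; apply: cderivableM; first (apply: cderivableM; first exact: HD).
  apply: cderivableV; first by rewrite expf_neq0 // -cmod_gt0 wr.
  exact: cderivable_idX.
apply: cderivableV; first exact: circ_sub_neq0 wr.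
exact: cderivable_subc.
Qed.

Lemma circ_derivable_power r H k : 0 < r -> circ_derivable r H ->
  circ_derivable r (fun w => H w * w ^- k).
Proof.
move=> r0 HD w wr; apply: cderivableM; first exact: HD.
apply: cderivableV; first by rewrite expf_neq0 // -cmod_gt0 wr.
exact: cderivable_idX.
Qed.

(** Iterate [1 / (w - y) = 1 / w + (y / w) / (w - y)] under the integral; the
    remainder is geometric of ratio [|y| / r]. *)
Lemma cauchy_kernel_series r H y : 0 < r -> cmod y < r -> circ_derivable r H ->
  series (fun k => cint r (fun w => H w * w ^- k.+1) * y ^+ k) @ \oo -->
  cint r (fun w => H w / (w - y)).
Proof.
move=> r0 yr HD.
pose rem k := cint r (fun w => H w * w ^- k / (w - y)).
have rem0 : rem 0%N = cint r (fun w => H w / (w - y)).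
  by apply: eq_cint => // w _; rewrite expr0 invr1 mulr1.
(* [y ^+ n * rem n] is the remainder after [n] terms. *)
have remS k : rem k = cint r (fun w => H w * w ^- k.+1) + y * rem k.+1.
  have DK := @circ_derivable_kernel r H y k.+1 r0 yr HD.
  have DP := @circ_derivable_power r H k.+1 r0 HD.
  have DyK : circ_derivable r (fun w => y * (H w * w ^- k.+1 / (w - y))).
    by move=> w wr; apply: cderivableM; [exact: cderivable_cst|exact: DK].
  rewrite /rem -(cintZ y r0 DK) -(cintD r0 DP DyK).
  apply: eq_cint => // w wr.
  have w0 : w != 0 by rewrite -cmod_gt0 wr.
  have wy := circ_sub_neq0 yr wr.
  by rewrite exprS; field; rewrite w0 wy expf_neq0.
have ser n : series (fun k => cint r (fun w => H w * w ^- k.+1) * y ^+ k) n = rem 0%N - y ^+ n * rem n.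
  elim: n => [|n IH]; first by rewrite series_sum big_nil expr0 mul1r subrr.
  by rewrite seriesSr IH (remS n) exprSr; ring.
have [M HM] := circ_bounded r0 HD.
have ry0 : 0 < r - cmod y by rewrite subr_gt0.
have M0 : 0 <= M by apply: le_trans (HM 0 _); rewrite ?cmod_ge0 // lexx ler01.
have rem_bound n : cmod (rem n) <= cis_lip R * r * (M * r ^- n / (r - cmod y)).
  apply: (cint_bound r0 (@circ_derivable_kernel r H y n r0 yr HD)) => t ht.
  rewrite !cmodM !cmodV cmodX -/(circ r t) cmod_circ //.
  have rn0 : 0 < r ^+ n by rewrite exprn_gt0.
  apply: ler_pM; [|by rewrite invr_ge0 cmod_ge0|by rewrite ler_pM2r ?invr_gt0 // HM|].
    by rewrite divr_ge0 ?cmod_ge0 // ltW.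
  have wy := circ_sub_neq0 yr (cmod_circ t r0).
  rewrite lef_pV2 ?posrE ?cmod_gt0 //.
  have := cmodD (circ r t - y) y; rewrite subrK cmod_circ //; lra.
rewrite -rem0; apply/cvg_seqP => e e0.
have q01 : 0 <= cmod y / r < 1.
  by rewrite divr_ge0 ?cmod_ge0 ?ltW //= ltr_pdivrMr // mul1r.
have [n0 Hn] := pow_small (cis_lip R * r * (M / (r - cmod y))) q01 e0.
exists n0 => n /Hn; apply: le_lt_trans.
rewrite ser addrAC subrr sub0r cmodN cmodM cmodX.
have h0 : 0 <= cmod y ^+ n by rewrite exprn_ge0 ?cmod_ge0.
apply: le_trans (ler_wpM2l h0 (rem_bound n)) _.
rewrite le_eqVlt; apply/orP; left; apply/eqP.
rewrite expr_div_n; set A := _ ^+ n; set B := (r ^+ n)^-1; set C := (r - _)^-1; ring.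
Qed.

(** The difference quotient of [F] at [y] is bounded near [y] and differentiable
    elsewhere, so its integral vanishes. *)
Lemma cauchy_formula r F y : 0 < r -> cmod y < r ->
  (forall w, cmod w <= r -> derivable F w 1) ->
  cint r (fun w => F w / (w - y)) = F y * cint r (fun w => 1 / (w - y)).
Proof.
move=> r0 yr FD.
have quot c w : w != y -> cmod w <= r -> derivable (fun w => (F w - c) / (w - y)) w 1.
  move=> wy wr; apply: cderivableM; first by apply: cderivableB; [exact: FD|exact: cderivable_cst].
  apply: cderivableV; first by rewrite subr_eq0.
  exact: cderivable_subc.
have [d d0 Hd] := derive1_cdiff (FD y (ltW yr)) ltr01.
have Z : cint r (fun w => (F w - F y) / (w - y)) = 0.
  apply: (@circle_integral_eq0 R _ y r (1 + cmod ((F^`())%classic y)) d) => //.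
    by move=> w wr wy; eexists; apply: derive1_cdiff; exact: quot.
  move=> w wy /Hd; rewrite mul1r => h; have wy0 : w - y != 0 by rewrite subr_eq0.
  rewrite cmodM cmodV ler_pdivrMr ?cmod_gt0 // mulrDl mul1r -cmodM.
  by rewrite -[F w - F y](subrK ((F^`())%classic y * (w - y))); apply: le_trans (cmodD _ _) _; rewrite lerD2r.
have K : circ_derivable r (fun w => 1 / (w - y)).
  move=> w wr; apply: cderivableM; first exact: cderivable_cst.
  apply: cderivableV; first exact: circ_sub_neq0 wr.
  exact: cderivable_subc.
have DF : circ_derivable r (fun w => (F w - F y) / (w - y)).
  move=> w wr; apply: quot; last by rewrite wr.
  by rewrite -subr_eq0 (circ_sub_neq0 yr wr).
have DyK : circ_derivable r (fun w => F y * (1 / (w - y))).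
  by move=> w wr; apply: cderivableM; [exact: cderivable_cst|exact: K].
rewrite -(cintZ (F y) r0 K) -[RHS]add0r -[X in X + _]Z -(cintD r0 DF DyK).
by apply: eq_cint => // w _; rewrite mulrA mulr1 -mulrDl subrK.
Qed.

(** Expand both sides of Cauchy's formula by [cauchy_kernel_series]. On the
    right, with the constant [1] in place of [F], only the term [1 / w]
    survives. *)
Theorem taylor_theorem r F : 0 < r -> (forall w, cmod w <= r -> derivable F w 1) ->
  exists b, power_series b F r.
Proof.
move=> r0 FD; pose kappa := cint r (fun w => w ^ (-1)).
have kappa0 : kappa != 0 by exact: cint_inv_neq0.
exists (fun k => kappa^-1 * cint r (fun w => F w * w ^- k.+1)) => y yr.
have one : circ_derivable r (fun=> 1 : R[i]) by move=> w _; exact: cderivable_cst.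
have E1 : cint r (fun w => 1 / (w - y)) = kappa.
  have S := cauchy_kernel_series r0 yr one.
  have c0 : cint r (fun w => 1 * w ^- 1) = kappa.
    by apply: (eq_cint r0) => w _; rewrite mul1r.
  have cS k : cint r (fun w => 1 * w ^- k.+2) = 0.
    have k0 : - k.+1%:Z != 0 by rewrite oppr_eq0.
    rewrite -(cint_monomial_eq0 r0 k0).
    by apply: (eq_cint r0) => w _; rewrite mul1r -opprD -PoszD addn1 -exprnN.
  apply: (cvg_seq_unique S); apply/cvg_seqP => e e0; exists 1%N => -[//|n] _.
  rewrite series_sum big_nat_recl // big1 => [|k _]; last by rewrite cS mul0r.
  by rewrite c0 addr0 expr0 mulr1 subrr cmod0.
have FC : circ_derivable r F by move=> w wr; apply: FD; rewrite wr.
have := cvgMl_tmp (a := kappa^-1) (cauchy_kernel_series r0 yr FC).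
rewrite cauchy_formula // E1 mulrCA mulVf // mulr1 => C.
have -> : series (fun k => kappa^-1 * cint r (fun w => F w * w ^- k.+1) * y ^+ k) =
  fun n => kappa^-1 * series (fun k => cint r (fun w => F w * w ^- k.+1) * y ^+ k) n.
  by apply/funext => n; rewrite !series_sum mulr_sumr; apply: eq_bigr => k _; rewrite mulrA.
exact: C.
Qed.

End TaylorTheorem.

(** * Uniqueness of Laurent expansions *)

Section LaurentUniqueness.
Variable R : realType.
Implicit Types (f : R[i] -> R[i]) (c d : int -> R[i]) (rho : R).

Lemma laurent_pos_geom d rho r (s : R[i]) : 0 < rho < r ->
  (series (fun k : nat => d k%:Z * r%:C ^+ k) @ \oo --> s) ->
  exists M q : R, [/\ 0 <= q < 1, 0 <= M & forall k : nat, cmod (d k%:Z) * rho ^+ k <= M * q ^+ k].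
Proof.
move=> /andP[rho0 rr] /series_term_bounded[M M0 HM].
have r0 : 0 < r by apply: lt_trans rr.
exists M, (rho / r); split; [|exact: ltW|].
  by rewrite divr_ge0 ?ltW //= ltr_pdivrMr // mul1r.
move=> k; have := HM k; rewrite cmodM cmodX cmodr gtr0_norm // => h.
have -> : M * (rho / r) ^+ k = (M / r ^+ k) * rho ^+ k by rewrite expr_div_n mulrA mulrAC.
have rk : 0 <= rho ^+ k by rewrite exprn_ge0 // ltW.
by rewrite ler_wpM2r // ler_pdivlMr ?exprn_gt0.
Qed.

Lemma laurent_neg_geom d rho r (s : R[i]) : 0 < r < rho ->
  (series (fun k : nat => d (- k.+1%:Z) * r%:C ^- k.+1) @ \oo --> s) ->
  exists M q : R, [/\ 0 <= q < 1, 0 <= M & forall k : nat, cmod (d (- k.+1%:Z)) * rho ^- k.+1 <= M * q ^+ k].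
Proof.
move=> /andP[r0 rr] /series_term_bounded[M M0 HM].
have rho0 : 0 < rho by apply: lt_trans rr.
have q0 : 0 <= r / rho < 1 by rewrite divr_ge0 ?ltW //= ltr_pdivrMr // mul1r.
exists M, (r / rho); split => //; first exact: ltW.
move=> k; have := HM k; rewrite cmodM cmodV cmodX cmodr gtr0_norm // ler_pdivrMr ?exprn_gt0 // => h.
rewrite ler_pdivrMr ?exprn_gt0 //; apply: le_trans h _.
have -> : M * (r / rho) ^+ k * rho ^+ k.+1 = M * r ^+ k * rho.
  by rewrite expr_div_n exprSr; field; rewrite expf_neq0 // gt_eqF.
rewrite exprSr mulrA; apply: ler_wpM2l; last exact: ltW.
by rewrite mulr_ge0 ?exprn_ge0 // ltW.
Qed.

(** Both halves of the series converge geometrically, hence uniformly, on the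
    circle; integrating the partial sums against [x ^ (- m - 1)] isolates
    [d m]. *)
Lemma laurent_zero d rho (r1 r2 : R) : 0 <= r1 -> r1 < rho -> rho < r2 ->
  (forall x, r1 < cmod x < r2 -> exists s1 s2 : R[i],
      [/\ series (fun k : nat => d k%:Z * x ^+ k) @ \oo --> s1,
          series (fun k : nat => d (- k.+1%:Z) * x ^- k.+1) @ \oo --> s2 &
          s1 + s2 = 0]) -> forall m, d m = 0.
Proof.
move=> r10 r1r rr2 H m.
have rho0 : 0 < rho by apply: le_lt_trans r1r.
have cmodE (t : R) : 0 < t -> cmod t%:C = t by move=> t0; rewrite cmodr gtr0_norm.
have [M1 [q1 [q1b M10 H1]]] : exists M q : R, [/\ 0 <= q < 1, 0 <= M &
    forall k : nat, cmod (d k%:Z) * rho ^+ k <= M * q ^+ k].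
  pose t := (rho + r2) / 2; have t0 : 0 < t by rewrite divr_gt0 // addr_gt0 // (lt_trans rho0).
  have [|s1 [s2 [h _ _]]] := H t%:C; first by rewrite cmodE // /t; lra.
  by apply: laurent_pos_geom h; rewrite rho0 /t; lra.
have [M2 [q2 [q2b M20 H2]]] : exists M q : R, [/\ 0 <= q < 1, 0 <= M &
    forall k : nat, cmod (d (- k.+1%:Z)) * rho ^- k.+1 <= M * q ^+ k].
  pose t := (r1 + rho) / 2; have t0 : 0 < t by rewrite divr_gt0 // ltr_wpDl.
  have [|s1 [s2 [_ h _]]] := H t%:C; first by rewrite cmodE // /t; lra.
  by apply: laurent_neg_geom h; rewrite t0 /t; lra.
pose P K (x : R[i]) := \sum_(0 <= k < K) d k%:Z * x ^ (k%:Z - m - 1)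
   + \sum_(0 <= k < K) d (- k.+1%:Z) * x ^ (- k.+1%:Z - m - 1).
have P_small K x : cmod x = rho ->
    cmod (P K x) <= (M1 * q1 ^+ K / (1 - q1) + M2 * q2 ^+ K / (1 - q2)) * rho ^ (- m - 1).
  move=> xr; have x0 : x != 0 by rewrite -cmod_gt0 xr.
  have [|s1 [s2 [h1 h2 h12]]] := H x; first by rewrite xr r1r.
  have -> : P K x = (series (fun k : nat => d k%:Z * x ^+ k) K - s1
     + (series (fun k : nat => d (- k.+1%:Z) * x ^- k.+1) K - s2)) * x ^ (- m - 1).
    rewrite addrACA -opprD h12 subr0 mulrDl !series_sum !mulr_suml; congr (_ + _).
      by apply: eq_bigr => k _; rewrite -mulrA exprnP -expfzDr // addrA.
    by apply: eq_bigr => k _; rewrite -mulrA exprnN -expfzDr // addrA.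
  have E : cmod (x ^ (- m - 1)) = rho ^ (- m - 1).
    by case: (- m - 1) => n; [rewrite -!exprnP cmodX xr|rewrite NegzE -!exprnN cmodV cmodX xr].
  have rm : 0 <= rho ^ (- m - 1) by rewrite exprz_ge0 // ltW.
  rewrite cmodM E; apply: ler_wpM2r => //.
  apply: le_trans (cmodD _ _) _; apply: lerD; rewrite cmod_sym.
    apply: geom_series_tail h1 => // k; rewrite cmodM cmodX xr; exact: H1.
  apply: geom_series_tail h2 => // k; rewrite cmodM cmodV cmodX xr; exact: H2.
have zpow (c : R[i]) (n : int) : circ_derivable rho (fun x : R[i] => c * x ^ (n - m - 1)).
  move=> x xr; apply: cderivableM; first exact: cderivable_cst.
  exact: (@circ_derivable_exprz R rho (n - m - 1) rho0 x xr).
have sumD I (s : seq I) (c : I -> R[i]) (n : I -> int) :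
    circ_derivable rho (fun x => \sum_(i <- s) c i * x ^ (n i - m - 1)) /\
    cint rho (fun x => \sum_(i <- s) c i * x ^ (n i - m - 1)) =
      (\sum_(i <- s | n i == m) c i) * cint rho (fun x => x ^ (-1)).
  elim: s => [|i s [IH1 IH2]].
    have -> : (fun x : R[i] => \sum_(i <- [::]) c i * x ^ (n i - m - 1)) = fun=> 0.
      by apply/funext => x; rewrite big_nil.
    split; first by move=> x _; exact: cderivable_cst.
    rewrite big_nil mul0r.
    have -> : (fun=> 0 : R[i]) = fun x : R[i] => 0 * 1 :> R[i] by apply/funext => x; rewrite mul0r.
    by rewrite (@cintZ R rho 0 (fun=> 1)) ?mul0r // => x _; exact: cderivable_cst.
  have E : (fun x : R[i] => \sum_(i <- i :: s) c i * x ^ (n i - m - 1)) =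
     fun x => c i * x ^ (n i - m - 1) + \sum_(i <- s) c i * x ^ (n i - m - 1).
    by apply/funext => x; rewrite big_cons.
  rewrite E; split; first by move=> x xr; apply: cderivableD; [exact: zpow|exact: IH1].
  rewrite (cintD rho0 (zpow (c i) (n i)) IH1) IH2 big_cons.
  rewrite (cintZ _ rho0 (@circ_derivable_exprz R rho (n i - m - 1) rho0)).
  case: eqVneq => [->|nm]; first by rewrite subrr sub0r mulrDl.
  by rewrite cint_monomial_eq0 ?subr_eq0 // mulr0 add0r.
have cintP K : (`|m| < K)%N -> cint rho (P K) = d m * cint rho (fun x => x ^ (-1)).
  move=> mK; have [D1 I1] := sumD _ (index_iota 0 K) (fun k => d k%:Z) (fun k => k%:Z).
  have [D2 I2] := sumD _ (index_iota 0 K) (fun k => d (- k.+1%:Z)) (fun k => - k.+1%:Z).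
  rewrite (cintD rho0 D1 D2) I1 I2 -mulrDl; congr (_ * _).
  case: m mK {H1 H2 P P_small zpow sumD D1 D2 I1 I2} => n /= nK.
    rewrite (eq_bigl (fun k => k == n)) => [|k]; last by apply/eqP/eqP => [[->]|->].
    by rewrite big_nat1_eq /= nK big1 ?addr0 // => k /eqP.
  rewrite big1 ?add0r => [|k /eqP //].
  rewrite (eq_bigl (fun k => k == n)) => [|k]; last first.
    by apply/eqP/eqP => [|->]; rewrite NegzE // => /oppr_inj[->].
  by rewrite big_nat1_eq /= (ltnW nK) NegzE.
have PD K : circ_derivable rho (P K).
  have [D1 _] := sumD _ (index_iota 0 K) (fun k => d k%:Z) (fun k => k%:Z).
  have [D2 _] := sumD _ (index_iota 0 K) (fun k => d (- k.+1%:Z)) (fun k => - k.+1%:Z).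
  by move=> x xr; apply: cderivableD; [exact: D1|exact: D2].
suff : d m * cint rho (fun x => x ^ (-1)) = 0.
  by move/eqP; rewrite mulf_eq0 (negPf (cint_inv_neq0 rho0)) orbF => /eqP.
apply: cmod_small => e e0.
pose A := cis_lip R * rho * rho ^ (- m - 1).
have A0 : 0 < A.
  by apply: mulr_gt0; [apply: mulr_gt0 => //; exact: cis_lip_gt0|exact: exprz_gt0].
have A20 : 0 < 2 * A by exact: mulr_gt0.
have eA : 0 < e / (2 * A) by exact: divr_gt0.
have [n1 N1] := pow_small (M1 / (1 - q1)) q1b eA.
have [n2 N2] := pow_small (M2 / (1 - q2)) q2b eA.
pose K := maxn (maxn n1 n2) `|m|.+1.
have K1 : (n1 <= K)%N by rewrite !leq_max leqnn.
have K2 : (n2 <= K)%N by rewrite !leq_max leqnn orbT.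
have Km : (`|m| < K)%N by rewrite !leq_max leqnn orbT.
rewrite -(cintP K Km); apply: le_trans (cint_bound rho0 (PD K) _) _.
  by move=> t _; apply: P_small; rewrite cmod_circ.
have := N1 K K1; have := N2 K K2; rewrite !ltr_pdivlMr // => h1 h2.
have -> : cis_lip R * rho * ((M1 * q1 ^+ K / (1 - q1) + M2 * q2 ^+ K / (1 - q2)) * rho ^ (- m - 1))
   = (M1 / (1 - q1) * q1 ^+ K) * A + (M2 / (1 - q2) * q2 ^+ K) * A by rewrite /A; ring.
lra.
Qed.

(** This makes [laurent_coef], which is a choice, computable: any expansion that
    can be exhibited is the one. *)
Lemma laurent_expansion_unique f rho c c' : laurent_expansion f rho c ->
  laurent_expansion f rho c' -> c = c'.
Proof.
move=> [r1 [r2 [r10 r1r rr2 H]]] [r1' [r2' [r10' r1r' rr2' H']]].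
apply/funext => m; apply/eqP; rewrite -subr_eq0; apply/eqP.
apply: (@laurent_zero (fun m => c m - c' m) rho (Num.max r1 r1') (Num.min r2 r2')).
- by rewrite le_max r10.
- by rewrite gt_max r1r.
- by rewrite lt_min rr2.
move=> x; rewrite gt_max lt_min => /andP[/andP[h1 h2] /andP[h3 h4]].
have [|s1 [s2 [a1 a2 a3]]] := H x; first by rewrite -/(cmod x) h1.
have [|t1 [t2 [b1 b2 b3]]] := H' x; first by rewrite -/(cmod x) h2.
have sB (u v : nat -> R[i]) (s t : R[i]) (z : nat -> R[i]) :
    series (fun k => u k * z k) @ \oo --> s -> series (fun k => v k * z k) @ \oo --> t ->
    series (fun k => (u k - v k) * z k) @ \oo --> s - t.
  move=> hs ht.
  have -> : series (fun k => (u k - v k) * z k) =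
     fun n => series (fun k => u k * z k) n - series (fun k => v k * z k) n.
    apply/funext => n; rewrite !series_sum -sumrB; apply: eq_bigr => k _.
    by rewrite mulrBl.
  exact: cvgB hs ht.
exists (s1 - t1), (s2 - t2); split; [exact: sB a1 b1|exact: sB a2 b2|].
by rewrite addrACA -opprD -a3 -b3 subrr.
Qed.

Lemma laurent_coefE f rho c : laurent_expansion f rho c -> laurent_coef f rho = c.
Proof.
move=> fc; have H : laurent_expansion f rho (laurent_coef f rho).
  exact: (@xgetPex _ (fun=> 0) [set c | laurent_expansion f rho c] (ex_intro _ c fc)).
exact: laurent_expansion_unique H fc.
Qed.

End LaurentUniqueness.

(** * Poles, and composition with the square *)

Section LocalPoles.
Variable R : realType.
Implicit Types (f g h q : R[i] -> R[i]) (z w : R[i]).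

Lemma holomorphicP f z : holomorphic_at f z <->
  exists2 e : R, 0 < e & forall w, cmod (w - z) < e -> derivable f w 1.
Proof. exact: nbhs_cmodP. Qed.

Lemma holomorphic_derivable f z : holomorphic_at f z -> derivable f z 1.
Proof. by move=> /holomorphicP[e e0]; apply; rewrite subrr cmod0. Qed.

Lemma has_poleP f z k : has_pole f z k <-> (0 < k)%N /\
  exists h (e : R), [/\ 0 < e, forall w, cmod (w - z) < e -> derivable h w 1,
   h z != 0 & forall w, w != z -> cmod (w - z) < e -> f w = h w / (w - z) ^+ k].
Proof.
split=> -[k0].
  case=> h [/holomorphicP[e1 e10 H1] hz /dnbhs_cmodP[e2 e20 H2]]; split => //.
  exists h, (Num.min e1 e2); split; rewrite ?lt_min ?e10 // => w.
    by rewrite lt_min => /andP[/H1].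
  by move=> wz; rewrite lt_min => /andP[_ /(H2 w wz)].
case=> h [e [e0 hD hz fh]]; split => //; exists h; split => //.
  by apply/holomorphicP; exists e.
by apply/dnbhs_cmodP; exists e.
Qed.

(** The common reason why a pole is not a regular point and why its order is
    unique: [h2] agrees off [z] with a function vanishing at [z]. *)
Lemma regular_factor_eq0 h1 h2 z j (e : R) : (0 < j)%N -> 0 < e ->
  derivable h1 z 1 -> derivable h2 z 1 ->
  (forall w, w != z -> cmod (w - z) < e -> h2 w = h1 w * (w - z) ^+ j) -> h2 z = 0.
Proof.
move=> j0 e0 d1 d2 E.
have dR : derivable (fun w => h1 w * (w - z) ^+ j) z 1.
  exact: cderivableM d1 (@cderivable_subcX R z j z).
have c2 := cderivable_cvg d2; have := cderivable_cvg dR.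
rewrite subrr expr0n gtn_eqF // mulr0 => /norm_cvg_lim <-.
apply/esym/norm_cvg_lim; apply: cvg_trans c2; apply: near_eq_cvg.
by apply/dnbhs_cmodP; exists e => // w wz /(E w wz).
Qed.

Lemma holomorphic_no_pole f z k : holomorphic_at f z -> ~ has_pole f z k.
Proof.
move=> fz /has_poleP[k0 [h [e [e0 hD hz fh]]]]; move/eqP: hz; apply.
apply: (@regular_factor_eq0 f h z k e) => //; first exact: holomorphic_derivable.
  by apply: hD; rewrite subrr cmod0.
move=> w wz /(fh w wz) ->; rewrite divfK // expf_neq0 // subr_eq0 //.
Qed.

Lemma pole_order_unique f z k k' : has_pole f z k -> has_pole f z k' -> k = k'.
Proof.
wlog kk : k k' / (k < k')%N => [W h h'|].
  by case: (ltngtP k k') => // kk; [exact: W|apply/esym; exact: W].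
move=> /has_poleP[k0 [h [e [e0 hD hz fh]]]] /has_poleP[k'0 [h' [e' [e'0 hD' hz' fh']]]].
exfalso; move/eqP: hz'; apply.
apply: (@regular_factor_eq0 h h' z (k' - k) (Num.min e e')).
- by rewrite subn_gt0.
- by rewrite lt_min e0.
- by apply: hD; rewrite subrr cmod0.
- by apply: hD'; rewrite subrr cmod0.
move=> w wz; rewrite lt_min => /andP[/(fh w wz) h1 /(fh' w wz)].
have wz0 : w - z != 0 by rewrite subr_eq0.
rewrite h1 => /(congr1 (fun x => x * (w - z) ^+ k')); rewrite divfK ?expf_neq0 // => <-.
by rewrite -{1}(subnK (ltnW kk)) exprD (mulrC (_ ^+ (k' - k))) mulrA divfK ?expf_neq0.
Qed.

Lemma square_near z (e : R) : 0 < e -> exists2 d : R, 0 < d &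
  forall w, cmod (w - z) < d -> cmod (w ^+ 2 - z ^+ 2) < e.
Proof.
move=> e0; have D : derivable (fun w : R[i] => w ^+ 2) z 1 by exact: cderivable_idX.
exact: cdiff_continuous (derive1_cdiff D) _ e0.
Qed.

Lemma cderivable_comp_square h w : derivable h (w ^+ 2) 1 -> derivable (fun x : R[i] => h (x ^+ 2)) w 1.
Proof.
exact: (@cderivable_comp R (fun x : R[i] => x ^+ 2) h w (@cderivable_idX R 2 w)).
Qed.

Lemma holomorphic_square g z : holomorphic_at g (z ^+ 2) ->
  holomorphic_at (fun x : R[i] => g (x ^+ 2)) z.
Proof.
move=> /holomorphicP[e e0 H]; have [d d0 Hd] := square_near z e0.
by apply/holomorphicP; exists d => // w /Hd/H/cderivable_comp_square.
Qed.

Lemma pole_square g z k : z != 0 -> has_pole g (z ^+ 2) k ->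
  has_pole (fun x : R[i] => g (x ^+ 2)) z k.
Proof.
move=> z0 /has_poleP[k0 [h [e [e0 hD hz fh]]]]; apply/has_poleP; split => //.
have [d d0 Hd] := square_near z e0.
have plus_neq0 w : cmod (w - z) < cmod z -> w + z != 0.
  move=> wz; apply/eqP => /eqP; rewrite addr_eq0 => /eqP wE; move: wz; rewrite wE -opprD cmodN.
  rewrite -mulr2n -mulr_natl cmodM cmodn; have := cmod_ge0 z; lra.
exists (fun w => h (w ^+ 2) / (w + z) ^+ k), (Num.min d (cmod z)).
split; rewrite ?lt_min ?d0 ?cmod_gt0 //.
- move=> w; rewrite lt_min => /andP[/Hd/hD hw /plus_neq0 wz].
  apply: cderivableM; first exact: cderivable_comp_square.
  apply: cderivableV; first by rewrite expf_neq0.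
  exact: cderivable_addcX.
- rewrite mulf_neq0 // invr_neq0 // expf_neq0 // plus_neq0 // subrr cmod0 cmod_gt0 //.
move=> w wz; rewrite lt_min => /andP[/Hd wd /plus_neq0 wpz].
have wz0 : w - z != 0 by rewrite subr_eq0.
rewrite fh //; last by rewrite -subr_eq0 subr_sqr mulf_neq0.
by rewrite subr_sqr exprMn invfM mulrA mulrAC.
Qed.

(** Excludes a pole of [g] at [0], because no [alpha_j^(-1/2)] is [0]. *)
Lemma pole_square0 g k : has_pole g 0 k -> has_pole (fun x : R[i] => g (x ^+ 2)) 0 (2 * k).
Proof.
move=> /has_poleP[k0 [h [e [e0 hD hz fh]]]]; apply/has_poleP; split; first by rewrite muln_gt0.
have [d d0 Hd] := square_near 0 e0; rewrite expr0n /= in Hd.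
exists (fun w => h (w ^+ 2)), d; split => //.
- by move=> w /Hd/hD/cderivable_comp_square.
- by rewrite expr0n.
move=> w w0 /Hd wd; rewrite fh // ?expf_neq0 //.
by rewrite !subr0 exprM.
Qed.

Lemma power_series_divX (b : nat -> R[i]) (F : R[i] -> R[i]) (r : R) : power_series b F r ->
  exists2 q, power_series (fun k => b k.+1) q r & forall u, cmod u < r -> F u = b 0%N + u * q u.
Proof.
move=> bF; exists (fun u => if u == 0 then b 1%N else (F u - b 0%N) / u); last first.
  move=> u ur; case: eqVneq => [u0|u0]; last by rewrite mulrCA mulfV // mulr1 addrC subrK.
  have r0 : 0 < r by apply: le_lt_trans ur; exact: cmod_ge0.
  by rewrite u0 (power_series0 r0 bF) mul0r addr0.
move=> u ur; case: eqVneq => [->|u0].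
  apply/cvg_seqP => e e0; exists 1%N => -[//|n] _.
  rewrite series_sum big_nat_recl // big1 => [|k _].
    by rewrite expr0 mulr1 addr0 subrr cmod0.
  by rewrite exprS mul0r mulr0.
apply/cvg_seqP => e e0; have eu : 0 < e * cmod u by rewrite mulr_gt0 // cmod_gt0.
have /cvg_seqP/(_ _ eu)[n0 H] := bF u ur; exists n0 => n n0n.
have := H n.+1 (leqW n0n); rewrite series_sum big_nat_recl // expr0 mulr1.
have -> : \sum_(0 <= i < n) b i.+1 * u ^+ i.+1 = series (fun k => b k.+1 * u ^+ k) n * u.
  by rewrite series_sum mulr_suml; apply: eq_bigr => k _; rewrite exprSr mulrA.
have -> : b 0%N + series (fun k => b k.+1 * u ^+ k) n * u - F u =
   (series (fun k => b k.+1 * u ^+ k) n - (F u - b 0%N) / u) * u.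
  by rewrite mulrBl divfK //; ring.
by rewrite cmodM ltr_pM2r // cmod_gt0.
Qed.

(** Serves to subtract principal parts: after division by [(w - z) ^ 2] the
    first two terms are polar and the last one is the regular part [q]. *)
Lemma taylor2 h z : holomorphic_at h z -> exists q, holomorphic_at q z /\
  exists2 e : R, 0 < e & forall w, cmod (w - z) < e ->
    h w = h z + (h^`())%classic z * (w - z) + q w * (w - z) ^+ 2.
Proof.
move=> /[dup] /holomorphic_derivable/derive1_cdiff hz /holomorphicP[e e0 H].
pose F u := h (u + z).
have e20 : 0 < e / 2 by rewrite divr_gt0.
have [b bF] : exists b, power_series b F (e / 2).
  apply: taylor_theorem => // w we; apply: (@cderivable_comp R (fun u => u + z) h).
    exact: cderivable_addc.
  by apply: H; rewrite addrK; lra.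
have [q1 bq1 E1] := power_series_divX bF.
have [q2 bq2 E2] := power_series_divX bq1.
have Fz : b 0%N = h z by rewrite -(power_series0 e20 bF) /F add0r.
have dF : b 1%N = (h^`())%classic z.
  have := power_series_derive1n 1 e20 bF; rewrite derive1n1 mul1r => <-.
  apply: cdiff_derive1; rewrite -[(h^`())%classic z]mulr1.
  apply: (@cdiff_comp R (fun u => u + z) h); last by rewrite add0r.
  move=> s s0; exists 1 => // w _; rewrite !subr0 add0r addrK mul1r subrr cmod0.
  by rewrite mulr_ge0 ?cmod_ge0 // ltW.
exists (fun w => q2 (w - z)); split.
  apply/holomorphicP; exists (e / 2) => // w we.
  apply: (@cderivable_comp R (fun w => w - z) q2); first exact: cderivable_subc.
  exact: power_series_derivable bq2 we.
exists (e / 2) => // w we.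
have -> : h w = F (w - z) by rewrite /F subrK.
by rewrite E1 // E2 // Fz dF; ring.
Qed.

(** The value of [phi] at [z] is the limit that defines the regularization. *)
Lemma regularizedE H phi z (e : R) : 0 < e -> derivable phi z 1 ->
  (forall w, w != z -> cmod (w - z) < e -> H w = phi w) ->
  forall w, cmod (w - z) < e -> regularized H z w = phi w.
Proof.
move=> e0 dphi E w we; rewrite /regularized; case: eqVneq => [->|wz]; last exact: E.
apply: norm_cvg_lim; apply: cvg_trans (cderivable_cvg dphi); apply: near_eq_cvg.
by apply/dnbhs_cmodP; exists e => // v vz /(E v vz).
Qed.

End LocalPoles.

(** * Principal parts *)

Section PrincipalParts.
Variable R : realType.
Implicit Types (f g h q : R[i] -> R[i]) (z w al A B : R[i]).

(** Written in terms of [1 - al * w], rather than [w - al^-1], so that both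
    geometric expansions have the coefficients [pole_coef] below. *)
Definition principal_part al A B w : R[i] := A / (1 - al * w) + B / (1 - al * w) ^+ 2.

Lemma pole_denom_neq0 al w : al != 0 -> w != al^-1 -> 1 - al * w != 0.
Proof.
move=> al0; apply: contra; rewrite subr_eq0 => /eqP E.
by apply/eqP/(mulfI al0); rewrite mulfV.
Qed.

Lemma principal_partE al A B w : al != 0 -> w != al^-1 ->
  principal_part al A B w = (- A / al) / (w - al^-1) + (B / al ^+ 2) / (w - al^-1) ^+ 2.
Proof.
move=> al0 w0; have d0 := pole_denom_neq0 al0 w0; rewrite /principal_part.
have E : 1 - al * w = - al * (w - al^-1) by field.
rewrite E; field; rewrite al0 /=; apply: contra d0 => /eqP H.
by rewrite -oppr_eq0 opprB mulrC H.
Qed.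

Lemma principal_part_derivable al A B w : 1 - al * w != 0 ->
  derivable (principal_part al A B) w 1.
Proof.
move=> d0; have D : derivable (fun w => 1 - al * w) w 1.
  apply: (@cderivableB R (fun=> 1) (fun w => al * w)); first exact: cderivable_cst.
  by apply: (@cderivableM R (fun=> al) id); [exact: cderivable_cst|exact: cderivable_id].
apply: (@cderivableD R (fun w => A / (1 - al * w)) (fun w => B / (1 - al * w) ^+ 2)).
  apply: (@cderivableM R (fun=> A) (fun w => (1 - al * w)^-1)); first exact: cderivable_cst.
  exact: (@cderivableV R (fun w => 1 - al * w)).
apply: (@cderivableM R (fun=> B) (fun w => ((1 - al * w) ^+ 2)^-1)); first exact: cderivable_cst.
apply: (@cderivableV R (fun w => (1 - al * w) ^+ 2)); first by rewrite expf_neq0.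
exact: (@cderivableX R (fun w => 1 - al * w)).
Qed.

Lemma principal_part_holomorphic al A B z : al != 0 -> z != al^-1 ->
  holomorphic_at (principal_part al A B) z.
Proof.
move=> al0 z0; apply/holomorphicP; exists (cmod (z - al^-1)).
  by rewrite cmod_gt0 subr_eq0.
move=> w wz; apply: principal_part_derivable; apply: pole_denom_neq0 => //.
by apply/eqP => wE; move: wz; rewrite wE cmod_sym ltxx.
Qed.

Lemma holomorphicB f g z : holomorphic_at f z -> holomorphic_at g z ->
  holomorphic_at (fun w => f w - g w) z.
Proof. by rewrite /holomorphic_at; apply: filterS2 => w; exact: cderivableB. Qed.

Lemma holomorphic_sum (I : eqType) (s : seq I) (F : I -> R[i] -> R[i]) z :
  (forall i, i \in s -> holomorphic_at (F i) z) ->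
  holomorphic_at (fun w => \sum_(i <- s) F i w) z.
Proof.
elim: s => [|i s IH] H.
  have -> : (fun w => \sum_(i <- [::]) F i w) = fun=> 0.
    by apply/funext => w; rewrite big_nil.
  by apply/holomorphicP; exists 1 => // w _; exact: cderivable_cst.
have -> : (fun w => \sum_(i <- i :: s) F i w) = fun w => F i w + \sum_(i <- s) F i w.
  by apply/funext => w; rewrite big_cons.
have h1 : holomorphic_at (F i) z by apply: H; rewrite mem_head.
have h2 : holomorphic_at (fun w => \sum_(i <- s) F i w) z.
  by apply: IH => j js; apply: H; rewrite in_cons js orbT.
by move: h1 h2; rewrite /holomorphic_at; apply: filterS2 => w; exact: cderivableD.
Qed.

Definition equal_near g q z := exists2 e : R, 0 < e &
  forall w, w != z -> cmod (w - z) < e -> g w = q w.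

(** A simple pole is the case [h al^-1 = 0] of this form, so that both kinds of
    poles are treated together. *)
Lemma double_pole_principal_part g h al (e : R) : al != 0 -> 0 < e ->
  holomorphic_at h al^-1 ->
  (forall w, w != al^-1 -> cmod (w - al^-1) < e -> g w = h w / (w - al^-1) ^+ 2) ->
  exists2 q, holomorphic_at q al^-1 & equal_near g (fun w => q w +
    principal_part al (- al * (h^`())%classic al^-1) (al ^+ 2 * h al^-1) w) al^-1.
Proof.
move=> al0 e0 hh gh; have [q [qh [e' e'0 E]]] := taylor2 hh.
exists q => //; exists (Num.min e e'); first by rewrite lt_min e0.
move=> w w0; rewrite lt_min => /andP[/(gh w w0) -> /E ->].
rewrite principal_partE //; set h0 := h _; set h1 := derive1 _ _.
have e1 : w - al^-1 != 0 by rewrite subr_eq0.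
set x := w - al^-1 in e1 *; field; by rewrite e1 al0.
Qed.

(** The term of index [j] in both sums of [shifted_coef]. *)
Definition pole_contribution f (alpha a : nat -> R[i]) (l : int) (j : nat) : R[i] :=
  (if `[< has_pole f (a j) 1 >] then simple_pole_contribution f alpha a l j else 0) +
  (if `[< has_pole f (a j) 2 >] then double_pole_contribution f alpha a l j else 0).

Lemma shifted_coefE f alpha a j0 l : shifted_coef f alpha a j0 l =
  (if l is Posz k then taylor_coef f (2 * k)%N else 0)
  + \sum_(1 <= j < j0.+1) pole_contribution f alpha a l j.
Proof.
rewrite /shifted_coef -addrA; congr (_ + _).
by rewrite [X in X + _]big_mkcond [X in _ + X]big_mkcond -big_split.
Qed.

(** The coefficients of the principal part of [g] at [1 / alpha_j] are read off
    from [(1 - alpha_j * x ^ 2) ^ k * f x] at [x = a_j]: in the variable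
    [w = x ^ 2] this is [(- alpha_j) ^ k] times the numerator [h w] of the pole,
    and the chain rule brings the factor [2 * a_j] of the derivative. *)
Lemma pole_data f g (alpha a : nat -> R[i]) j k :
  (forall x, f x = g (x ^+ 2)) -> alpha j != 0 -> a j ^+ 2 = (alpha j)^-1 ->
  k = 1%N \/ k = 2%N -> has_pole g (alpha j)^-1 k ->
  exists A B,
    (exists2 q, holomorphic_at q (alpha j)^-1 &
      equal_near g (fun w => q w + principal_part (alpha j) A B w) (alpha j)^-1) /\
    forall l, pole_contribution f alpha a l j =
      - (1 / 2) * (alpha j ^ l * A + (l + 1)%:~R * alpha j ^ l * B).
Proof.
move=> fg al0 a2 k12 gk.
have a0 : a j != 0.
  by apply/eqP => aE; move: a2; rewrite aE expr0n /= => /eqP; rewrite eq_sym invr_eq0 (negPf al0).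
have fk : has_pole f (a j) k.
  have -> : f = fun x => g (x ^+ 2) by apply/funext.
  by apply: pole_square => //; rewrite a2.
have [_ [h [e [e0 hD hz gh]]]] := (has_poleP g (alpha j)^-1 k).1 gk.
have hh : holomorphic_at h (alpha j)^-1 by apply/holomorphicP; exists e.
have [d d0 Hd] := square_near (a j) e0; rewrite a2 in Hd.
(* [x + a j] must not vanish, hence the radius [cmod (a j)]. *)
have cleared (x : R[i]) : x != a j -> cmod (x - a j) < Num.min d (cmod (a j)) ->
    (1 - alpha j * x ^+ 2) ^+ k * f x = (- alpha j) ^+ k * h (x ^+ 2).
  move=> xa; rewrite lt_min => /andP[/Hd xd xa'].
  have xpa : x + a j != 0.
    apply/eqP => /eqP; rewrite addr_eq0 => /eqP xE; move: xa'; rewrite xE -opprD cmodN.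
    by rewrite -mulr2n -mulr_natl cmodM cmodn; have := cmod_ge0 (a j); lra.
  have x2 : x ^+ 2 - (alpha j)^-1 != 0 by rewrite -a2 subr_sqr mulf_neq0 // subr_eq0.
  have x2' : x ^+ 2 != (alpha j)^-1 by rewrite -subr_eq0.
  rewrite fg (gh _ x2' xd).
  have -> : 1 - alpha j * x ^+ 2 = - alpha j * (x ^+ 2 - (alpha j)^-1) by field.
  by rewrite exprMn -mulrA [X in _ * X = _]mulrC divfK ?expf_neq0.
have dn : 0 < Num.min d (cmod (a j)) by rewrite lt_min d0 cmod_gt0.
pose phi x := (- alpha j) ^+ k * h (x ^+ 2).
have phid : cdiff phi (a j) ((- alpha j) ^+ k * ((h^`())%classic (alpha j)^-1 * (2 * a j))).
  have c1 : cdiff (fun x : R[i] => x ^+ 2) (a j) (2 * a j).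
    move=> s s0; exists s => // w ws.
    have -> : w ^+ 2 - a j ^+ 2 - 2 * a j * (w - a j) = (w - a j) * (w - a j) by ring.
    by rewrite cmodM ler_wpM2r ?cmod_ge0 // ltW.
  have c2 : cdiff h (a j ^+ 2) ((h^`())%classic (alpha j)^-1).
    by rewrite a2; apply/derive1_cdiff/holomorphic_derivable.
  have c3 : cdiff (fun x : R[i] => (- alpha j) ^+ k * x) (h (a j ^+ 2)) ((- alpha j) ^+ k).
    move=> s s0; exists 1 => // w _; rewrite -mulrBr subrr cmod0.
    by rewrite mulr_ge0 ?cmod_ge0 // ltW.
  exact: cdiff_comp (cdiff_comp c1 c2) c3.
have reg := regularizedE dn (cdiff_derivable phid) cleared.
have reg_a := reg (a j); rewrite subrr cmod0 /phi a2 in reg_a; have {}reg_a := reg_a dn.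
have phi_reg x : cmod (x - a j) < Num.min d (cmod (a j)) ->
  phi x = regularized (fun x => (1 - alpha j * x ^+ 2) ^+ k * f x) (a j) x by move=> /reg.
have reg_d := cdiff_derive1 (cdiff_near_eq dn phi_reg phid).
have aal : alpha j * a j ^+ 2 = 1 by rewrite a2 mulfV.
case: k12 => kE; subst k.
  pose h1 w := h w * (w - (alpha j)^-1).
  have h1h : holomorphic_at h1 (alpha j)^-1.
    apply/holomorphicP; exists e; first exact: e0.
    move=> w /hD dh.
    exact: (@cderivableM R h (fun w => w - (alpha j)^-1) w dh (@cderivable_subc R (alpha j)^-1 w)).
  have [|q qh qE] := @double_pole_principal_part g h1 (alpha j) e al0 e0 h1h.
    move=> w w0 we; rewrite gh // /h1; have w0' : w - (alpha j)^-1 != 0 by rewrite subr_eq0.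
    by rewrite expr1 expr2 invfM mulrA mulfK.
  have h1d : (h1^`())%classic (alpha j)^-1 = h (alpha j)^-1.
    apply: cdiff_derive1 => s s0.
    have [r r0 Hr] := cdiff_continuous (derive1_cdiff (holomorphic_derivable hh)) s0.
    exists r => // w /Hr Hw.
    have -> : h1 w - h1 (alpha j)^-1 - h (alpha j)^-1 * (w - (alpha j)^-1) =
      (h w - h (alpha j)^-1) * (w - (alpha j)^-1) by rewrite /h1; ring.
    by rewrite cmodM ler_wpM2r ?cmod_ge0 // ltW.
  exists (- alpha j * h (alpha j)^-1), 0; split.
    exists q => //; move: qE; rewrite h1d /h1 subrr !mulr0; exact.
  move=> l; rewrite /pole_contribution asboolT // asboolF; last first.
    by move=> /(pole_order_unique fk).
  have -> : simple_pole_contribution f alpha a l j = - (1 / 2) * alpha j ^ l *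
      regularized (fun x : R[i] => (1 - alpha j * x ^+ 2) ^+ 1 * f x) (a j) (a j) by [].
  rewrite reg_a expr1; set p := alpha j ^ l; set n := (l + 1)%:~R; ring.
have [|q qh qE] := @double_pole_principal_part g h (alpha j) e al0 e0 hh.
  by move=> w w0 we; rewrite gh.
exists (- alpha j * (h^`())%classic (alpha j)^-1), (alpha j ^+ 2 * h (alpha j)^-1); split.
  by exists q.
move=> l; rewrite /pole_contribution asboolF; last first.
  by move=> /(pole_order_unique fk).
rewrite asboolT // /double_pole_contribution reg_a reg_d add0r.
set p := alpha j ^ l; set h0 := h _; set h1 := derive1 _ _; set n := (l + 1)%:~R.
have -> : 1 / 4 * (p * a j) * ((- alpha j) ^+ 2 * (h1 * (2 * a j))) =
  1 / 2 * p * (alpha j * (alpha j * a j ^+ 2)) * h1 by field.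
by rewrite aal; field.
Qed.

End PrincipalParts.

(** * Geometric expansions of principal parts *)

Section GeometricExpansions.
Variable R : realType.
Implicit Types (x w al A B : R[i]).

Lemma cvg_series_lin (c d : R[i]) (u v : nat -> R[i]) (s t : R[i]) :
  series u @ \oo --> s -> series v @ \oo --> t ->
  series (fun k => c * u k + d * v k) @ \oo --> c * s + d * t.
Proof.
move=> us vt.
have -> : series (fun k => c * u k + d * v k) = fun n => c * series u n + d * series v n.
  by apply/funext => n; rewrite !series_sum !mulr_sumr -big_split.
exact: cvgD (cvgMl_tmp us) (cvgMl_tmp vt).
Qed.

Lemma eq_cvg_series (u v : nat -> R[i]) (s : R[i]) : u =1 v ->
  series u @ \oo --> s -> series v @ \oo --> s.
Proof. by move=> /funext ->. Qed.

Lemma cvg_series_bigsum (I : eqType) (r : seq I) (u : I -> nat -> R[i]) (s : I -> R[i]) :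
  (forall i, i \in r -> series (u i) @ \oo --> s i) ->
  series (fun k => \sum_(i <- r) u i k) @ \oo --> \sum_(i <- r) s i.
Proof.
elim: r => [|i r IH] H.
  apply/cvg_seqP => e e0; exists 0%N => n _.
  rewrite series_sum big1 => [|k _]; last by rewrite big_nil.
  by rewrite big_nil subrr cmod0.
have -> : (fun k => \sum_(j <- i :: r) u j k) = fun k => 1 * u i k + 1 * \sum_(j <- r) u j k.
  by apply/funext => k; rewrite big_cons !mul1r.
rewrite big_cons -(mul1r (s i)) -[X in _ + X]mul1r; apply: cvg_series_lin.
  by apply: H; rewrite mem_head.
by apply: IH => j jr; apply: H; rewrite in_cons jr orbT.
Qed.

Lemma geometric_cvg x : cmod x < 1 -> series (fun k => x ^+ k) @ \oo --> (1 - x)^-1.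
Proof.
move=> x1; have x10 : 1 - x != 0.
  by rewrite subr_eq0; apply/eqP => xE; move: x1; rewrite -xE cmod1 ltxx.
apply/cvg_seqP => e e0.
have q01 : 0 <= cmod x < 1 by rewrite cmod_ge0.
have [n0 H] := pow_small ((cmod (1 - x))^-1) q01 e0.
exists n0 => n /H; apply: le_lt_trans.
have -> : series (fun k => x ^+ k) n - (1 - x)^-1 = - ((1 - x)^-1 * x ^+ n).
  elim: n => [|n IH]; first by rewrite series_sum big_nil expr0; ring.
  by rewrite seriesSr addrAC IH exprS; field.
by rewrite cmodN cmodM cmodV cmodX.
Qed.

(** Termwise differentiation gives convergence; the sum follows by multiplying
    by [1 - x]. *)
Lemma geometric2_cvg x : cmod x < 1 ->
  series (fun k => k.+1%:R * x ^+ k) @ \oo --> ((1 - x) ^+ 2)^-1.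
Proof.
move=> x1; have x10 : 1 - x != 0.
  by rewrite subr_eq0; apply/eqP => xE; move: x1; rewrite -xE cmod1 ltxx.
have geo : power_series (fun=> 1 : R[i]) (fun w => (1 - w)^-1) 1.
  move=> w w1; apply: eq_cvg_series (geometric_cvg w1) => k.
  by rewrite mul1r.
have [G [GP _]] := power_series_derive geo.
have GC : series (fun k => k.+1%:R * x ^+ k) @ \oo --> G x.
  by apply: eq_cvg_series (GP x x1) => k; rewrite mulr1.
suff -> : ((1 - x) ^+ 2)^-1 = G x by [].
have key n : series (fun k => k.+1%:R * x ^+ k) n * (1 - x) =
    series (fun k => x ^+ k) n - n%:R * x ^+ n.
  elim: n => [|n IH]; first by rewrite !series_sum !big_nil; ring.
  rewrite !seriesSr mulrDl IH exprS -[n.+1]addn1 natrD; ring.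
have small : (fun n => n%:R * x ^+ n) @ \oo --> (0 : R[i]).
  have -> : (fun n => n%:R * x ^+ n) = fun n => n.+1%:R * x ^+ n - x ^+ n.
    by apply/funext => n; rewrite -[n.+1]addn1 natrD mulrDl mul1r addrK.
  rewrite -[X in _ --> X]subr0.
  exact: cvgB (cvg_series_cvg_0 (cvgP _ GC)) (cvg_series_cvg_0 (cvgP _ (geometric_cvg x1))).
have c1 : (fun n => series (fun k => k.+1%:R * x ^+ k) n * (1 - x)) @ \oo --> G x * (1 - x).
  exact: cvgMr_tmp GC.
have c2 : (fun n => series (fun k => k.+1%:R * x ^+ k) n * (1 - x)) @ \oo --> (1 - x)^-1.
  rewrite (funext key) -[X in _ --> X]subr0.
  exact: cvgB (geometric_cvg x1) small.
have := cvg_seq_unique c1 c2 => /(canRL (mulfK x10)) ->.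
by rewrite -invfM -expr2.
Qed.

(** The coefficient of [w ^ l] in the expansion of the principal part near [0],
    extended to all integers [l] by the same formula. *)
Definition pole_coef al A B (l : int) : R[i] := al ^ l * A + (l + 1)%:~R * al ^ l * B.

Lemma principal_part_inner al A B w : cmod (al * w) < 1 ->
  series (fun k : nat => pole_coef al A B k%:Z * w ^+ k) @ \oo --> principal_part al A B w.
Proof.
move=> h; rewrite /principal_part.
apply: eq_cvg_series (cvg_series_lin (c := A) (d := B) (geometric_cvg h) (geometric2_cvg h)) => k.
rewrite /pole_coef exprMn -exprnP -PoszD addn1 -pmulrn; ring.
Qed.

(** Near infinity the same coefficients occur, at the negative exponents and with
    the opposite sign. Hence half the sum of both expansions differs from the
    inner one by [- pole_coef / 2] at every exponent. *)
Lemma principal_part_outer al A B w : 1 < cmod (al * w) ->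
  series (fun k : nat => - pole_coef al A B (- k.+1%:Z) * w ^- k.+1) @ \oo --> principal_part al A B w.
Proof.
move=> h; have aw0 : al * w != 0 by rewrite -cmod_gt0; apply: lt_trans h.
set x := (al * w)^-1.
have x1 : cmod x < 1 by rewrite cmodV invf_lt1 // (lt_trans _ h).
have g1 := geometric_cvg x1; have g2 := geometric2_cvg x1.
have g3 := cvg_series_lin (c := 1) (d := -1) g2 g1.
have E : - A * x * (1 - x)^-1 + B * x * (1 * (1 - x) ^- 2 + -1 * (1 - x)^-1) = principal_part al A B w.
  have d0 : 1 - al * w != 0.
    by rewrite subr_eq0; apply/eqP => E; move: h; rewrite -E cmod1 ltxx.
  rewrite /principal_part /x; set y := al * w in aw0 d0 *; field.
  by rewrite aw0 d0 /= -oppr_eq0 opprB.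
rewrite -E; apply: eq_cvg_series (cvg_series_lin (c := - A * x) (d := B * x) g1 g3) => k.
rewrite /pole_coef -exprnN.
have -> : (- k.+1%:Z + 1)%:~R = - k%:R :> R[i].
  by rewrite -[k.+1]addn1 PoszD opprD subrK rmorphN /= -pmulrn.
rewrite /x exprVn exprMn -[k.+1]addn1 natrD !exprD !expr1.
move: aw0; rewrite mulf_eq0 negb_or => /andP[al0 w0].
field; by rewrite al0 w0 !expf_neq0.
Qed.

End GeometricExpansions.

(** * Removal of the poles in a disc *)

Section RemovePoles.
Variable R : realType.
Implicit Types (g q F : R[i] -> R[i]) (w z : R[i]) (alpha A B : nat -> R[i]) (s : seq nat).

Definition principal_parts alpha A B s w :=
  \sum_(j <- s) principal_part (alpha j) (A j) (B j) w.

Lemma principal_parts_holomorphic alpha A B s z :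
  (forall j, j \in s -> alpha j != 0 /\ z != (alpha j)^-1) ->
  holomorphic_at (principal_parts alpha A B s) z.
Proof.
move=> H; apply: (@holomorphic_sum R nat s (fun j => principal_part (alpha j) (A j) (B j))).
by move=> j /H[? ?]; exact: principal_part_holomorphic.
Qed.

(** Taking punctured limits everywhere removes the removable singularities and
    leaves the regular points unchanged. *)
Lemma lim_near_derivable (D q : R[i] -> R[i]) z : holomorphic_at q z -> equal_near D q z ->
  derivable (fun y => lim (D w @[w --> y^'])) z 1.
Proof.
move=> /holomorphicP[e e0 qD] [e' e'0 E].
pose m := Num.min e e'; have m0 : 0 < m by rewrite lt_min e0.
apply: (@cderivable_near_eq R q _ z m m0); last by apply: qD; rewrite subrr cmod0.
move=> y; rewrite lt_min => /andP[ye ye'].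
apply/esym/norm_cvg_lim; apply: cvg_trans (cderivable_cvg (qD y ye)); apply: near_eq_cvg.
apply/dnbhs_cmodP; have [yz|yz] := eqVneq y z.
  by exists e'; first exact: e'0; move=> w; rewrite yz => wz we; rewrite E.
exists (Num.min (e' - cmod (y - z)) (cmod (y - z))).
  by rewrite lt_min subr_gt0 ye' cmod_gt0 subr_eq0.
move=> w wy; rewrite lt_min => /andP[w1 w2]; rewrite E //.
  by apply/eqP => wz; move: w2; rewrite wz cmod_sym ltxx.
by apply: le_lt_trans (cmod_triangle w y z) _; lra.
Qed.

(** Near [1 / alpha_j] the difference of [g] and all principal parts is the
    regular part of [g] minus the other principal parts, so the difference
    extends to a holomorphic function on the whole disc, which has a Taylor
    series there. *)
Lemma remove_poles g alpha A B s (rho r : R) : uniq s ->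
  (forall j, j \in s -> alpha j != 0) ->
  {in s &, injective alpha} ->
  (forall z, cmod z < rho -> (forall j, j \in s -> z != (alpha j)^-1) -> holomorphic_at g z) ->
  (forall j, j \in s -> exists2 q, holomorphic_at q (alpha j)^-1 &
     equal_near g (fun w => q w + principal_part (alpha j) (A j) (B j) w) (alpha j)^-1) ->
  0 < r < rho ->
  exists b F, power_series b F r /\
    forall w, cmod w < r -> (forall j, j \in s -> w != (alpha j)^-1) ->
      g w = F w + principal_parts alpha A B s w.
Proof.
move=> us al0 ainj gh gq /andP[r0 rr].
pose D w := g w - principal_parts alpha A B s w.
have Dreg z : cmod z < rho -> (forall j, j \in s -> z != (alpha j)^-1) -> holomorphic_at D z.
  move=> zr zs; apply: holomorphicB; first exact: gh.
  by apply: principal_parts_holomorphic => j js; split; [exact: al0|exact: zs].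
have Dnear z : cmod z < rho -> exists2 q, holomorphic_at q z & equal_near D q z.
  move=> zr; have [[j [js zj]]|nz] := pselect (exists j, j \in s /\ z = (alpha j)^-1); last first.
    exists D; last by exists 1.
    apply: Dreg => // j js; apply/eqP => zE; apply: nz; by exists j.
  have [q qh [e e0 E]] := gq j js.
  exists (fun w => q w - principal_parts alpha A B (rem j s) w); last first.
    exists e; first exact: e0.
    move=> w; rewrite zj => wz /(E w wz) gE.
    rewrite /D gE /principal_parts (perm_big _ (perm_to_rem js)) big_cons /=; ring.
  rewrite zj; apply: holomorphicB; first exact: qh.
  apply: principal_parts_holomorphic => i; rewrite mem_rem_uniq // inE => /andP[ij is_].
  split; first exact: al0.
  by apply/eqP => /invr_inj /(ainj _ _ js is_) ji; move: ij; rewrite ji eqxx.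
pose F y := lim (D w @[w --> y^']).
have [b bF] : exists b, power_series b F r.
  apply: taylor_theorem; first exact: r0.
  move=> w wr; have [q qh qE] := Dnear w (le_lt_trans wr rr).
  exact: lim_near_derivable qh qE.
exists b, F; split; first exact: bF.
move=> w wr ws; have Dw := Dreg w (lt_trans wr rr) ws.
have -> : F w = D w.
  by apply: norm_cvg_lim; exact: cderivable_cvg (holomorphic_derivable Dw).
by rewrite /D subrK.
Qed.

(** The Laurent coefficients of [x |-> g (x ^+ 2)], if [c] are those of [g]. Note
    that [Negz n] is [- (n + 1)], an even integer when [n] is odd. *)
Definition even_ext (c : int -> R[i]) (k : int) : R[i] :=
  match k with
  | Posz n => if odd n then 0 else c (Posz n./2)
  | Negz n => if odd n then c (Negz n./2) else 0
  end.

Lemma even_extE (c : int -> R[i]) l : even_ext c (2 * l) = c l.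
Proof.
case: l => n; first by rewrite -PoszM mul2n /= odd_double doubleK.
by rewrite NegzE mulrN -PoszM mul2n doubleS -NegzE /= odd_double uphalf_double.
Qed.

Lemma even_ext_odd (c : int -> R[i]) k : (forall l, 2 * l != k) -> even_ext c k = 0.
Proof.
move=> H; case: k H => n H /=; case: ifP => // on; exfalso.
  move: (H n./2%:Z); rewrite -PoszM mul2n halfK on subn0 eqxx //.
move: (H (Negz n./2)); rewrite NegzE mulrN -PoszM mul2n doubleS halfK on NegzE.
by rewrite subn1 prednK ?eqxx //; case: (n) on.
Qed.

Lemma cvg_reindexed_series (u v : nat -> R[i]) (l : R[i]) (m : nat -> nat) :
  (forall n, series v n = series u (m n)) -> (forall n, (n./2 <= m n)%N) ->
  series u @ \oo --> l -> series v @ \oo --> l.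
Proof.
move=> vu nm /cvg_seqP H; apply/cvg_seqP => e /H[n0 Hn]; exists n0.*2 => n n0n.
by rewrite vu; apply: Hn; apply: leq_trans (nm n); rewrite -(doubleK n0) half_leq.
Qed.

Lemma even_ext_pos (c : int -> R[i]) (x l : R[i]) :
  series (fun k : nat => c k%:Z * (x ^+ 2) ^+ k) @ \oo --> l ->
  series (fun k : nat => even_ext c k%:Z * x ^+ k) @ \oo --> l.
Proof.
apply: (@cvg_reindexed_series _ _ _ uphalf); last by move=> n; rewrite uphalf_half leq_addl.
elim=> [|n IH]; first by rewrite !series_sum !big_nil.
rewrite seriesSr IH /= uphalfE /=; have [on|en] := boolP (odd n).
  by rewrite mul0r addr0 uphalf_half on add1n.
by rewrite uphalf_half (negPf en) add0n seriesSr -exprM mul2n halfK (negPf en) subn0.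
Qed.

Lemma even_ext_neg (c : int -> R[i]) (x l : R[i]) :
  series (fun k : nat => c (- k.+1%:Z) * (x ^+ 2) ^- k.+1) @ \oo --> l ->
  series (fun k : nat => even_ext c (- k.+1%:Z) * x ^- k.+1) @ \oo --> l.
Proof.
apply: (@cvg_reindexed_series _ _ _ half) => //.
elim=> [|n IH]; first by rewrite !series_sum !big_nil.
rewrite seriesSr IH /= uphalf_half; have [on|en] := boolP (odd n); last first.
  by rewrite mul0r addr0 add0n.
rewrite add1n seriesSr NegzE -exprM mul2n doubleS halfK on subn1.
by rewrite prednK //; case: (n) on.
Qed.

End RemovePoles.

(** * Sums of products of modes *)

Section ModeSums.
Variable R : realType.
Local Notation K := R[i].
Implicit Types (S c : int -> K) (u : seq int) (n m : int).

Lemma fsum_seq (I : choiceType) (F : I -> K) (r : seq I) : uniq r ->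
  (forall i, i \notin r -> F i = 0) ->
  \sum_(i \in [set: I]) F i = \sum_(i <- r) F i.
Proof.
move=> ur Fr; rewrite fsbig_supp; apply: fsbig_fwiden => //.
  move=> i [_ /= Fi]; apply: contrapT => /negP ir; apply: Fi; exact: Fr.
by move=> i [_ /= H]; apply: contrapT => Fi; apply: H.
Qed.

(** Additivity of [\sum_(i \in _)] holds for families of finite support only. *)
Lemma fsum_sub (I : choiceType) (F G : I -> K) (r r' : seq I) :
  (forall i, i \notin r -> F i = 0) -> (forall i, i \notin r' -> G i = 0) ->
  \sum_(i \in [set: I]) (F i - G i) =
  \sum_(i \in [set: I]) F i - \sum_(i \in [set: I]) G i.
Proof.
move=> Fr Gr; pose s := undup (r ++ r').
have Fs i : i \notin s -> F i = 0.
  by rewrite mem_undup mem_cat negb_or => /andP[/Fr].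
have Gs i : i \notin s -> G i = 0.
  by rewrite mem_undup mem_cat negb_or => /andP[_ /Gr].
rewrite !(@fsum_seq I _ s) ?undup_uniq // ?sumrB // => i is_.
by rewrite Fs // Gs // subrr.
Qed.

Lemma tmodeM (p q : int) u : (tmode K p * tmode K q) u = (u == [:: p; q])%:R.
Proof.
rewrite [LHS](_ : _ = ncmul (tmode K p) (tmode K q) u) // /ncmul /tmode.
case: u => [|x [|y u]].
- by rewrite big_nat1 /= mul0r.
- by rewrite big_nat_recr // big_nat1 /= mul0r mulr0 addr0 eqseq_cons andbF.
have [u0|u0] := eqVneq u [::].
  rewrite u0 /= !big_nat_recr //= big_geq // !eqseq_cons !andbT /= mul0r add0r add0r mulr0 addr0.
  by rewrite -natrM mulnb.
rewrite big1_seq => [|i].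
  by rewrite !eqseq_cons (negPf u0) !andbF.
rewrite mem_index_iota => /andP[_ iu].
case: i iu => [|[|i]] iu; first by rewrite /= mul0r.
  by rewrite /= ?take0 ?drop0 !eqseq_cons (negPf u0) !andbF mulr0.
by rewrite /= !eqseq_cons andbF mul0r.
Qed.

(** The coefficient at the word [u] of [\sum_k S k t_(n-k) t_(m+k)]. *)
Definition mode_sum S n m u : K :=
  if u is [:: p; q] then (p + q == n + m)%:R * S (n - p) else 0.

Lemma mode_support (I : choiceType) (e : I -> int) (s : I -> K) n m u : injective e ->
  exists r : seq I, forall i, i \notin r -> s i * (u == [:: n - e i; m + e i])%:R = 0.
Proof.
move=> einj; have [[i0 ui0]|H] := pselect (exists i, u = [:: n - e i; m + e i]).
  exists [:: i0] => i; rewrite inE => ii0; case: eqP => [ui|_]; last by rewrite mulr0.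
  move: ui; rewrite ui0 => -[/addrI/oppr_inj/einj E _].
  by rewrite E eqxx in ii0.
by exists [::] => i _; case: eqP => [ui|_]; [case: H; exists i|rewrite mulr0].
Qed.

(** A word [[:: p; q]] occurs only for [k = n - p], provided that
    [p + q = n + m]. The index is general so that sums over all [k], over even
    [k] and over nonnegative even [k] are evaluated at once. *)
Lemma mode_sumE (I : choiceType) (e : I -> int) (s : I -> K) S n m u : injective e ->
  (forall i, S (e i) = s i) -> (forall k, (forall i, e i != k) -> S k = 0) ->
  \sum_(i \in [set: I]) s i * (u == [:: n - e i; m + e i])%:R = mode_sum S n m u.
Proof.
move=> einj Se S0; have [[i0 ui0]|H] := pselect (exists i, u = [:: n - e i; m + e i]).
  rewrite (@fsum_seq I _ [:: i0]) // => [|i].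
    rewrite big_seq1 ui0 eqxx mulr1 /mode_sum.
    have -> : n - e i0 + (m + e i0) = n + m by ring.
    by rewrite eqxx mul1r opprB addrC subrK Se.
  rewrite inE => ii0; case: eqP => [ui|_]; last by rewrite mulr0.
  move: ui; rewrite ui0 => -[/addrI/oppr_inj/einj E _].
  by rewrite E eqxx in ii0.
rewrite fsbig1 => [|i _]; last first.
  by case: eqP => [ui|_]; [case: H; exists i|rewrite mulr0].
rewrite /mode_sum; case: u H => [|p [|q [|? ?]]] // H.
case: eqP => [pq|_]; last by rewrite mul0r.
rewrite S0 ?mulr0 // => i; apply/eqP => ei; apply: H; exists i.
rewrite ei; congr [:: _; _]; first by ring.
by rewrite addrA [m + n]addrC -pq; ring.
Qed.

Lemma ncsum_modes c n m u :
  ncsum (fun k : int => c k *: (tmode K (n - k) * tmode K (m + k))) u = mode_sum c n m u.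
Proof.
rewrite -(@mode_sumE int id c) //; last by move=> k /(_ k); rewrite eqxx.
rewrite /ncsum; apply: eq_fsbigr => k _.
by rewrite [LHS](_ : _ = c k * (tmode K (n - k) * tmode K (m + k)) u) // tmodeM.
Qed.

Lemma ncsum_exchange_terms (I : choiceType) (l : I -> int) (s : I -> K) (t : int -> K) n m u :
  injective l -> (forall i, t (l i) = s i) -> (forall k, (forall i, l i != k) -> t k = 0) ->
  ncsum (fun i => s i *: exchange_term R n m (l i)) u =
  mode_sum (even_ext t) n m u - mode_sum (even_ext t) m n u.
Proof.
move=> linj tl t0; pose e i := 2 * l i.
have einj : injective e by move=> i j /mulfI h; apply: linj; exact: h.
have Se i : even_ext t (e i) = s i by rewrite even_extE.
have S0 k : (forall i, e i != k) -> even_ext t k = 0.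
  move=> H; have [[k' E]|nk] := pselect (exists k', 2 * k' = k).
    rewrite -E even_extE; apply: t0 => i; apply: contra_neq (H i) => li.
    by rewrite /e li.
  by apply: even_ext_odd => k'; apply/eqP => E; apply: nk; exists k'.
have [r Hr] := mode_support s n m u einj; have [r' Hr'] := mode_support s m n u einj.
rewrite -!(mode_sumE _ _ _ einj Se S0) -(fsum_sub Hr Hr').
rewrite /ncsum; apply: eq_fsbigr => i _.
by rewrite [LHS](_ : _ = s i * ((tmode K (n - e i) * tmode K (m + e i)) u
   - (tmode K (m - e i) * tmode K (n + e i)) u)) // !tmodeM mulrBr.
Qed.

(** The first bracket brings [c1] with the first ordering of the modes and [c2]
    with the second one, and the other bracket the converse, so only the sum of
    both Laurent sequences matters. *)
Lemma exchange_integralE f (R1 R2 : R) (I : choiceType) (l : I -> int) (s : I -> K) (t : int -> K) n m :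
  injective l -> (forall i, t (l i) = s i) -> (forall k, (forall i, l i != k) -> t k = 0) ->
  (forall k, laurent_coef f (R1 / R2) k + laurent_coef f (R2 / R1) k = 2 * even_ext t k) ->
  exchange_integral f R1 R2 n m = 2 *: ncsum (fun i => s i *: exchange_term R n m (l i)).
Proof.
move=> linj tl t0 ct; apply/funext => u.
rewrite [RHS](_ : _ = 2 * ncsum (fun i => s i *: exchange_term R n m (l i)) u) //.
rewrite (@ncsum_exchange_terms I l s t) //.
set c1 := laurent_coef f (R1 / R2) in ct *; set c2 := laurent_coef f (R2 / R1) in ct *.
transitivity ((mode_sum c1 n m u - mode_sum c2 m n u) + (mode_sum c2 n m u - mode_sum c1 m n u)).
  by rewrite -!ncsum_modes.
have msum a b : mode_sum c1 a b u + mode_sum c2 a b u = 2 * mode_sum (even_ext t) a b u.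
  rewrite /mode_sum; case: u => [|p [|q [|? ?]]]; rewrite ?mulr0 ?addr0 //.
  by rewrite -mulrDr ct mulrCA.
have := msum n m; have := msum m n => h1 h2.
have -> : forall a b c d : K, (a - b) + (c - d) = (a + c) - (d + b) by move=> *; ring.
by rewrite h2 h1 mulrBr.
Qed.

End ModeSums.

(** * Laurent coefficients on the two circles *)

Section CircleExpansions.
Variable R : realType.
Variables (f g : R[i] -> R[i]) (N : option nat) (alpha a : nat -> R[i]).
Hypothesis g_merom : meromorphic g.
Hypothesis fg : forall x, f x = g (x ^+ 2).
Hypothesis f_orders : forall z k, has_pole f z k -> k = 1%N \/ k = 2%N.
Hypothesis alpha_neq0 : forall j, pole_index N j -> alpha j != 0.
Hypothesis a_sqrt : forall j, pole_index N j -> a j ^+ 2 = (alpha j)^-1.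
Hypothesis f_poles : forall z, (exists k, has_pole f z k) <->
  exists2 j, pole_index N j & z = a j \/ z = - a j.

Let f_def : f = fun x => g (x ^+ 2). Proof. exact/funext. Qed.

(** The poles of [g] are the squares of those of [f], with the same order. *)
Lemma pole_location y k : has_pole g y k ->
  (k = 1%N \/ k = 2%N) /\ exists2 j, pole_index N j & y = (alpha j)^-1.
Proof.
move=> gy; have [y0|y0] := eqVneq y 0.
  have f0 : has_pole f 0 (2 * k) by rewrite f_def; apply: pole_square0; rewrite -y0.
  have [j Nj aj] := (f_poles 0).1 (ex_intro _ _ f0).
  have a0 : a j ^+ 2 = 0.
    by case: aj => [<-|/eqP]; [rewrite expr0n|rewrite eq_sym oppr_eq0 => /eqP ->; rewrite expr0n].
  by move: a0; rewrite a_sqrt // => /eqP; rewrite invr_eq0 (negPf (alpha_neq0 Nj)).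
pose z := sqrtc y; have zy : z ^+ 2 = y by exact: sqr_sqrtc.
have z0 : z != 0 by apply: contra y0; rewrite -zy => /eqP ->; rewrite expr0n.
have fz : has_pole f z k by rewrite f_def; apply: pole_square => //; rewrite zy.
split; first exact: f_orders fz.
have [j Nj aj] := (f_poles z).1 (ex_intro _ _ fz); exists j => //.
by rewrite -a_sqrt // -zy; case: aj => ->; rewrite ?sqrrN.
Qed.

Lemma holomorphic_off_poles y : (forall j, pole_index N j -> y != (alpha j)^-1) ->
  holomorphic_at g y.
Proof.
move=> H; case: (g_merom y) => // -[k /pole_location[_ [j Nj yE]]].
by have := H j Nj; rewrite yE eqxx.
Qed.

Lemma pole_at_alpha j : pole_index N j ->
  exists2 k, k = 1%N \/ k = 2%N & has_pole g (alpha j)^-1 k.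
Proof.
move=> Nj; case: (g_merom (alpha j)^-1) => [gh|[k gk]]; last first.
  by exists k => //; have [] := pole_location gk.
have [k fk] : exists k, has_pole f (a j) k by apply/f_poles; exists j => //; left.
exfalso; apply: (@holomorphic_no_pole R f (a j) k _ fk).
by rewrite f_def; apply: holomorphic_square; rewrite (a_sqrt Nj).
Qed.

Definition local_expansion (A B : nat -> R[i]) j :=
  (exists2 q, holomorphic_at q (alpha j)^-1 &
     equal_near g (fun w => q w + principal_part (alpha j) (A j) (B j) w) (alpha j)^-1) /\
  forall l, pole_contribution f alpha a l j = - (1 / 2) * pole_coef (alpha j) (A j) (B j) l.

Lemma local_expansions : exists A B, forall j, pole_index N j -> local_expansion A B j.
Proof.
have H j : exists AB : R[i] * R[i], pole_index N j -> local_expansion (fun=> AB.1) (fun=> AB.2) j.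
  have [Nj|nNj] := boolP (pole_index N j); last by exists (0, 0).
  have [k k12 gk] := pole_at_alpha Nj.
  have [A [B AB]] := pole_data fg (alpha_neq0 Nj) (a_sqrt Nj) k12 gk.
  by exists (A, B).
have [AB HAB] := choice H.
by exists (fun j => (AB j).1), (fun j => (AB j).2).
Qed.

Definition pole_abs j : R := (Num.sqrt (Normc.normc (alpha j)))^-1.

Lemma pole_abs_gt0 j : pole_index N j -> 0 < pole_abs j.
Proof. by move=> /alpha_neq0; rewrite invr_gt0 sqrtr_gt0 -cmod_gt0. Qed.

Lemma pole_abs_sqr j : pole_abs j ^+ 2 = (cmod (alpha j))^-1.
Proof. by rewrite exprVn sqr_sqrtr // cmod_ge0. Qed.

Lemma alpha_sqr_lt1 j x : pole_index N j -> (cmod (alpha j * x ^+ 2) < 1) = (cmod x < pole_abs j).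
Proof.
move=> Nj; have al0 : 0 < cmod (alpha j) by rewrite cmod_gt0 alpha_neq0.
rewrite cmodM cmodX mulrC -ltr_pdivlMr // mul1r -pole_abs_sqr.
by rewrite ltr_pXn2r // nnegrE ?cmod_ge0 // ltW // pole_abs_gt0.
Qed.

Lemma alpha_sqr_gt1 j x : pole_index N j -> (1 < cmod (alpha j * x ^+ 2)) = (pole_abs j < cmod x).
Proof.
move=> Nj; have al0 : 0 < cmod (alpha j) by rewrite cmod_gt0 alpha_neq0.
rewrite cmodM cmodX mulrC -ltr_pdivrMr // mul1r -pole_abs_sqr.
by rewrite ltr_pXn2r // nnegrE ?cmod_ge0 // ltW // pole_abs_gt0.
Qed.

(** The Laurent coefficients of [g] beyond the first [j0] poles, respectively
    before the first pole, if [b] are the Taylor coefficients of the function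
    left after removal of these poles. *)
Definition outer_coef (b A B : nat -> R[i]) j0 (l : int) : R[i] :=
  if l is Posz k then b k
  else - \sum_(1 <= j < j0.+1) pole_coef (alpha j) (A j) (B j) l.

Definition inner_coef (b A B : nat -> R[i]) j0 (l : int) : R[i] :=
  if l is Posz k then b k + \sum_(1 <= j < j0.+1) pole_coef (alpha j) (A j) (B j) l
  else 0.

Hypothesis alpha_inj : forall i j, pole_index N i -> pole_index N j ->
  alpha i = alpha j -> i = j.

(** Both circles share the data [b], [A], [B]: the same Taylor series is combined
    with the outer expansions of the principal parts on the first circle and
    with the inner ones on the second. The radii [p] separate the circles from
    the poles, and [t < t'] leave room before the pole of index [j0 + 1]. *)
Lemma circle_expansions j0 (t t' : R) :
  (forall j, (1 <= j <= j0)%N -> pole_index N j) -> 0 < t < t' ->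
  (forall j, pole_index N j -> (j0 < j)%N -> t' <= pole_abs j) ->
  exists b A B,
  [/\ forall rho p : R, 0 <= p -> p < rho -> rho < t ->
        (forall j, (1 <= j <= j0)%N -> pole_abs j <= p) ->
        laurent_expansion f rho (even_ext (outer_coef b A B j0)),
      forall rho p : R, 0 < rho -> rho < p -> p <= t ->
        (forall j, (1 <= j <= j0)%N -> p <= pole_abs j) ->
        laurent_expansion f rho (even_ext (inner_coef b A B j0)) /\
        (forall k : nat, taylor_coef f (2 * k)%N = inner_coef b A B j0 k) &
      forall l j, (1 <= j <= j0)%N ->
        pole_contribution f alpha a l j = - (1 / 2) * pole_coef (alpha j) (A j) (B j) l].
Proof.
move=> Nj0 /andP[t0 tt'] far.
have [A [B AB]] := local_expansions.
have sN j : j \in index_iota 1 j0.+1 -> pole_index N j.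
  by rewrite mem_index_iota ltnS; exact: Nj0.
have t'0 : 0 < t' by apply: lt_trans tt'.
have [||||||b [F [bF gF]]] := @remove_poles R g alpha A B (index_iota 1 j0.+1) (t' ^+ 2) (t ^+ 2).
- exact: iota_uniq.
- by move=> j /sN; exact: alpha_neq0.
- by move=> i j /sN iN /sN jN; exact: alpha_inj.
- move=> z zt zs; apply: holomorphic_off_poles => j Nj; have [jj0|j0j] := leqP j j0.
    by apply: zs; rewrite mem_index_iota ltnS jj0 andbT; case/andP: Nj.
  apply/eqP => zE; move: zt; rewrite zE cmodV -pole_abs_sqr ltNge => /negP; apply.
  by apply: lerXn2r; rewrite ?nnegrE ?far //; apply: ltW => //; exact: pole_abs_gt0.
- by move=> j /sN /AB[].
- by rewrite exprn_gt0 //= ltr_pXn2r // nnegrE ltW.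
exists b, A, B; split; last by move=> l j /Nj0/AB[].
- move=> rho p p0 prho rhot Pp; exists p, t; split => // x; rewrite -/(cmod x) => /andP[px xt].
  have wt : cmod (x ^+ 2) < t ^+ 2.
    by rewrite cmodX ltr_pXn2r ?nnegrE ?cmod_ge0 // ltW.
  have big j : j \in index_iota 1 j0.+1 -> 1 < cmod (alpha j * x ^+ 2).
    move=> js; rewrite alpha_sqr_gt1; last exact: sN.
    by apply: le_lt_trans px; apply: Pp; rewrite mem_index_iota ltnS in js.
  exists (F (x ^+ 2)), (principal_parts alpha A B (index_iota 1 j0.+1) (x ^+ 2)); split.
  + by apply: even_ext_pos; exact: bF.
  + apply: even_ext_neg.
    have := @cvg_series_bigsum R nat (index_iota 1 j0.+1) _ _
      (fun j js => principal_part_outer (A := A j) (B := B j) (big j js)).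
    apply: eq_cvg_series => k; rewrite /= -sumrN mulr_suml; apply: eq_bigr => j _.
    by rewrite mulNr.
  + rewrite fg gF // => j js; apply/eqP => xE; have := big j js.
    by rewrite xE mulfV ?cmod1 ?ltxx // alpha_neq0 // sN.
- move=> rho p rho0 rhop pt pP.
  have small x j : cmod x < p -> j \in index_iota 1 j0.+1 -> cmod (alpha j * x ^+ 2) < 1.
    move=> xp js; rewrite alpha_sqr_lt1; last exact: sN.
    by apply: lt_le_trans xp _; apply: pP; rewrite mem_index_iota ltnS in js.
  have expand x : cmod x < p ->
      series (fun k : nat => even_ext (inner_coef b A B j0) k%:Z * x ^+ k) @ \oo --> f x.
    move=> xp; have p0 : 0 < p by apply: lt_trans rhop.
    have wt : cmod (x ^+ 2) < t ^+ 2.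
      have xt := lt_le_trans xp pt.
      by rewrite cmodX ltr_pXn2r ?nnegrE ?cmod_ge0 // ltW.
    rewrite fg gF // => [|j js]; last first.
      apply/eqP => xE; have := small x j xp js.
      by rewrite xE mulfV ?cmod1 ?ltxx // alpha_neq0 // sN.
    apply: even_ext_pos.
    have C2 := @cvg_series_bigsum R nat (index_iota 1 j0.+1) _ _
      (fun j js => principal_part_inner (A := A j) (B := B j) (small x j xp js)).
    have := cvg_series_lin (c := 1) (d := 1) (bF _ wt) C2.
    rewrite !mul1r; apply: eq_cvg_series => k.
    by rewrite !mul1r mulrDl mulr_suml.
  split.
    exists 0, p; split => // x /andP[_ xp]; exists (f x), 0; split.
    + exact: expand.
    + apply: even_ext_neg; apply/cvg_seqP => e e0; exists 0%N => n _.
      by rewrite series_sum big1 ?subrr ?cmod0 // => k _; rewrite mul0r.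
    + by rewrite addr0.
  move=> k; have p0 : 0 < p by apply: lt_trans rhop.
  have ps : power_series (fun k : nat => even_ext (inner_coef b A B j0) k%:Z) f p.
    by move=> x xp; exact: expand.
  by rewrite (taylor_coefE _ p0 ps) PoszM even_extE.
Qed.

(** The inner and outer coefficients differ by [pole_coef] at every exponent,
    each pole counting for one term, and its contribution is minus half of that
    term. *)
Lemma average_coef b A B j0 l :
  (forall k : nat, taylor_coef f (2 * k)%N = inner_coef b A B j0 k) ->
  (forall l j, (1 <= j <= j0)%N ->
    pole_contribution f alpha a l j = - (1 / 2) * pole_coef (alpha j) (A j) (B j) l) ->
  outer_coef b A B j0 l + inner_coef b A B j0 l = 2 * shifted_coef f alpha a j0 l.
Proof.
move=> tE cE; rewrite shifted_coefE.
have -> : \sum_(1 <= j < j0.+1) pole_contribution f alpha a l j =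
    - (1 / 2) * \sum_(1 <= j < j0.+1) pole_coef (alpha j) (A j) (B j) l.
  by rewrite mulr_sumr; apply: eq_big_nat => j; rewrite ltnS => /cE.
by case: l => k; [rewrite tE /inner_coef /=; field|rewrite /=; field].
Qed.

End CircleExpansions.

(** * Exchange relations *)

Section PoleRadii.
Variable R : realType.
Variables (N : option nat) (alpha : nat -> R[i]).
Hypothesis radius_incr : forall j j', pole_index N j -> pole_index N j' -> (j < j')%N ->
  (pole_radius N alpha j < pole_radius N alpha j')%E.

Lemma pole_index_le i j : (0 < i <= j)%N -> pole_index N j -> pole_index N i.
Proof.
move=> /andP[i0 ij] /andP[_]; rewrite /pole_index i0 /=.
by case: N => // n; exact: leq_trans.
Qed.

Lemma pole_radiusE j : pole_index N j -> pole_radius N alpha j = (pole_abs alpha j)%:E.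
Proof. by rewrite /pole_radius => ->. Qed.

Lemma pole_abs_lt i j : pole_index N i -> pole_index N j -> (i < j)%N ->
  pole_abs alpha i < pole_abs alpha j.
Proof.
by move=> Ni Nj ij; have := radius_incr Ni Nj ij; rewrite !pole_radiusE // lte_fin.
Qed.

Lemma pole_abs_le i j : pole_index N i -> pole_index N j -> (i <= j)%N ->
  pole_abs alpha i <= pole_abs alpha j.
Proof.
move=> Ni Nj; rewrite leq_eqVlt => /orP[/eqP -> //|ij].
by rewrite ltW // pole_abs_lt.
Qed.

Lemma alpha_injective i j : pole_index N i -> pole_index N j -> alpha i = alpha j -> i = j.
Proof.
move=> Ni Nj ij; case: (ltngtP i j) => // h.
  by have := pole_abs_lt Ni Nj h; rewrite /pole_abs ij ltxx.
by have := pole_abs_lt Nj Ni h; rewrite /pole_abs ij ltxx.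
Qed.

(** A finite radius to work with, also when no pole of index above [j] exists. *)
Lemma room_below_pole (x : R) j : 0 < x -> (x%:E < pole_radius N alpha j.+1)%E ->
  exists t t', [/\ x < t, t < t' &
    forall i, pole_index N i -> (j < i)%N -> t' <= pole_abs alpha i].
Proof.
move=> x0 xj; have [Nj|nNj] := boolP (pole_index N j.+1); last first.
  exists (x + 1), (x + 2); split; [lra|lra|] => i Ni ji; case/negP: nNj.
  exact: pole_index_le Ni.
move: xj; rewrite pole_radiusE // lte_fin => xP.
exists ((x + pole_abs alpha j.+1) / 2), (pole_abs alpha j.+1); split; [lra|lra|].
by move=> i Ni ji; exact: pole_abs_le.
Qed.

End PoleRadii.

Theorem theorem8 (R : realType) (f : R[i] -> R[i]) (N : option nat)
    (alpha a : nat -> R[i])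
    (f_merom : meromorphic_in_square f)
    (f_orders : forall z k, has_pole f z k -> k = 1%N \/ k = 2%N)
    (alpha_neq0 : forall j, pole_index N j -> alpha j != 0)
    (a_sqrt : forall j, pole_index N j -> a j ^+ 2 = (alpha j)^-1)
    (f_poles : forall z, (exists k, has_pole f z k) <->
       exists2 j, pole_index N j & z = a j \/ z = - a j)
    (radius1 : (1 < pole_radius N alpha 1)%E)
    (radius_incr : forall j j', pole_index N j -> pole_index N j' -> (j < j')%N ->
       (pole_radius N alpha j < pole_radius N alpha j')%E)
    (R1 R2 : R) (R1_gt0 : 0 < R1) (R2_gt0 : 0 < R2)
    (A : algType R[i]) (phi : {lrmorphism ncseries R[i] -> A}) :
  (((1 <= R1 / R2 /\ ((R1 / R2)%:E < pole_radius N alpha 1)%E) \/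
    (1 <= (R1 / R2)^-1 /\ (((R1 / R2)^-1)%:E < pole_radius N alpha 1)%E)) ->
   forall n m : int,
     phi (exchange_integral f R1 R2 n m) = 0 <->
     phi (ncsum (fun l : nat =>
            taylor_coef f (2 * l)%N *: exchange_term R n m l%:Z)) = 0)
  /\
  (forall j0 : nat, pole_index N j0 ->
   ((pole_radius N alpha j0 < (R1 / R2)%:E < pole_radius N alpha j0.+1)%E \/
    (pole_radius N alpha j0 < ((R1 / R2)^-1)%:E < pole_radius N alpha j0.+1)%E) ->
   forall n m : int,
     phi (exchange_integral f R1 R2 n m) = 0 <->
     phi (ncsum (fun l : int =>
            shifted_coef f alpha a j0 l *: exchange_term R n m l)) = 0).
Proof.
have [g g_merom fg] := f_merom.
have alpha_inj := alpha_injective radius_incr.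
have rhoV : R2 / R1 = (R1 / R2)^-1 by rewrite invf_div.
set rho := R1 / R2 in rhoV *.
have rho0 : 0 < rho by rewrite divr_gt0.
have double (x y : ncseries R[i]) : x = 2 *: y -> phi x = 0 <-> phi y = 0.
  have E : phi (2 *: y) = 2 *: phi y by rewrite linearZ.
  have two : (2 : R[i]) != 0 by rewrite pnatr_eq0.
  move=> ->; split=> h; last by rewrite E h scaler0.
  by rewrite -(scalerK two (phi y)) -E h scaler0.
(* Exchanging the two circles inverts [rho] and swaps the two expansions. *)
have swap x k : rho = x \/ rho^-1 = x ->
    laurent_coef f rho k + laurent_coef f (R2 / R1) k =
    laurent_coef f x k + laurent_coef f x^-1 k.
  by rewrite rhoV => -[<-|<-] //; rewrite invrK addrC.
split.
  move=> hrho n m; apply: double.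
  have [x [rx x1 xP]] : exists x, [/\ rho = x \/ rho^-1 = x, 1 <= x &
      (x%:E < pole_radius N alpha 1)%E].
    by case: hrho => -[h1 h2]; [exists rho|exists rho^-1]; split => //; [left|right].
  have x0 : 0 < x by apply: lt_le_trans x1.
  have [t [t' [xt tt' far]]] := room_below_pole radius_incr x0 xP.
  have t0 : 0 < t by apply: lt_trans xt.
  have tt : 0 < t < t' by rewrite t0.
  have none j : (1 <= j <= 0)%N -> pole_index N j by case: j.
  have [b [A' [B [_ inner _]]]] := circle_expansions g_merom fg f_orders alpha_neq0 a_sqrt
    f_poles alpha_inj none tt far.
  have V1 : x^-1 <= 1 by rewrite invf_le1.
  have vacuous (j : nat) : (1 <= j <= 0)%N -> t <= pole_abs alpha j by case: j.
  have [Lx tE] := inner x t x0 xt (lexx t) vacuous.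
  have [LV _] := inner x^-1 t (etrans (invr_gt0 x) x0) (le_lt_trans V1 (le_lt_trans x1 xt))
    (lexx t) vacuous.
  apply: (@exchange_integralE R f R1 R2 nat Posz _ (inner_coef alpha b A' B 0)).
  - by move=> i j [].
  - by move=> l; rewrite tE.
  - by case=> k H //; have := H k; rewrite eqxx.
  - by move=> k; rewrite (swap x) // (laurent_coefE Lx) (laurent_coefE LV) mulr2n mulrDl mul1r.
move=> j0 Nj0 hrho n m; apply: double.
have j00 : (0 < j0)%N by case/andP: Nj0.
have Nj j : (1 <= j <= j0)%N -> pole_index N j by move=> /pole_index_le; apply.
have N1 : pole_index N 1 by apply: Nj; rewrite leqnn.
have [x [rx Px xP]] : exists x, [/\ rho = x \/ rho^-1 = x, pole_abs alpha j0 < x &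
    (x%:E < pole_radius N alpha j0.+1)%E].
  case: hrho => /andP[]; rewrite pole_radiusE // lte_fin => h1 h2; [exists rho|exists rho^-1].
    by split => //; left.
  by split => //; right.
have P1 : 1 < pole_abs alpha 1 by move: radius1; rewrite pole_radiusE // lte_fin.
have Pj0 : 1 < pole_abs alpha j0 by apply: lt_le_trans P1 (pole_abs_le radius_incr N1 Nj0 j00).
have x1 : 1 < x by apply: lt_trans Px.
have x0 : 0 < x by apply: lt_trans x1.
have [t [t' [xt tt' far]]] := room_below_pole radius_incr x0 xP.
have t0 : 0 < t by apply: lt_trans xt.
have tt : 0 < t < t' by rewrite t0.
have [b [A' [B [outer inner contrib]]]] := circle_expansions g_merom fg f_orders alpha_neq0
  a_sqrt f_poles alpha_inj Nj tt far.
have V1 : x^-1 < 1 by rewrite invf_lt1.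
have Lx : laurent_expansion f x (even_ext (outer_coef alpha b A' B j0)).
  apply: (outer x (pole_abs alpha j0)) => //; first by apply: ltW; apply: lt_trans Pj0.
  by move=> j jj; apply: (pole_abs_le radius_incr (Nj j jj) Nj0); case/andP: jj.
have [|j jj|LV tE] := inner x^-1 1 (etrans (invr_gt0 x) x0) V1.
- exact: ltW (lt_trans x1 xt).
- apply: ltW; apply: lt_le_trans P1 _.
  by apply: (pole_abs_le radius_incr N1 (Nj j jj)); case/andP: jj.
apply: (@exchange_integralE R f R1 R2 int id _ (shifted_coef f alpha a j0)) => //.
- by move=> k /(_ k); rewrite eqxx.
move=> k; rewrite (swap x) // (laurent_coefE Lx) (laurent_coefE LV).
have avg l := average_coef l tE contrib.
by case: k => k; rewrite /even_ext; case: (odd k); rewrite ?avg // addr0 mulr0.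
Qed.
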